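(* Let $F(x_1,x_2)=\sum_{i=0}^5 a_i x_1^{5-i}x_2^i$ be the generic binary quintic over $\mathbb{C}$, and let $\mathcal{B}_0,\ldots,\mathcal{B}_5\in\mathbb{C}[a_0,\ldots,a_5]^{SL_2}$ be the six degree $24$ invariants of $F$ defined in the context. Then for every integer $d>0$ which is a multiple of $48$, every invariant of the binary quintic $F$ which is homogeneous of degree $d$ in the coefficients $a_0,\ldots,a_5$ can be written as a polynomial (with complex coefficients) in $\mathcal{B}_0,\ldots,\mathcal{B}_5$.
   Context: The base field is $\mathbb{C}$. For a binary form $F(\mathbf{x})=\sum_{i=0}^p a_i x_1^{p-i}x_2^i$ in $\mathbf{x}=(x_1,x_2)$ and $g\in GL_2$, define $gF$ by $(gF)(\mathbf{x})=F(g^{-1}\mathbf{x})$. An invariant of $F$ of degree $d$ is a polynomial $I(F)=I(a_0,\ldots,a_p)$, homogeneous of degree $d$ in the coefficients, such that for some integer $\omega$ (the weight) $I(gF)=(\det g)^{-\omega}I(F)$ for all $g\in GL_2$. The ring of invariants is denoted $\mathbb{C}[a_0,\ldots,a_p]^{SL_2}$, graded by degree. For pairs $b=(b_1,b_2)$, $c=(c_1,c_2)$ write $(bc)=b_1c_2-b_2c_1$. For a binary quartic $Q(\mathbf{x})=q_0x_1^4+4q_1x_1^3x_2+6q_2x_1^2x_2^2+4q_3x_1x_2^3+q_4x_2^4$ put $$S(Q)=q_0q_4-4q_1q_3+3q_2^2,\qquad T(Q)=q_0q_2q_4+2q_1q_2q_3-q_2^3-q_0q_3^2-q_1^2q_4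 .$$ Definition of $\mathcal{B}_0,\ldots,\mathcal{B}_5$: write the binary quintic $F$ in terms of its homogeneous roots $\lambda_1,\ldots,\lambda_5$ (pairs of complex numbers) as $F(\mathbf{x})=(\mathbf{x}\lambda_1)\cdots(\mathbf{x}\lambda_5)$, and for $1\le i\le 5$ let $Q_i(\mathbf{x})=\prod_{j\ne i}(\mathbf{x}\lambda_j)$, a binary quartic. With a new variable $z$, set $$\prod_{i=1}^5\Big(\big(S(Q_i)^3-27\,T(Q_i)^2\big)z-S(Q_i)^3\Big)=\sum_{i=0}^5\mathcal{B}_i(F)\,z^{5-i}.$$ The $\mathcal{B}_i(F)$ depend only on $F$ and are homogeneous polynomial invariants of degree $24$ in the coefficients of $F$. *)

(* Defs.v *)
From HB Require Import structures.
From mathcomp Require Import all_boot all_order all_fingroup all_algebra.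
From mathcomp Require Import boolp reals complex.
From mathcomp Require Import mpoly ring.

Set Implicit Arguments.
Unset Strict Implicit.
Unset Printing Implicit Defensive.

Import GRing.Theory Num.Theory.
Local Open Scope ring_scope.

Section Forms.
Context {A : comNzRingType}.

Definition bracket (b c : A * A) : A := b.1 * c.2 - b.2 * c.1.

(* Binary forms are elements of {mpoly A[2]}; x = (x_1, x_2) is
   ('X_ord0, 'X_ord_max). *)
Definition mon (p i : nat) : 'X_{1..2} :=
  (U_(ord0) *+ (p - i) + U_(ord_max) *+ i)%MM.

Definition bform (p : nat) (a : 'I_p.+1 -> A) : {mpoly A[2]} :=
  \sum_(i < p.+1) a i *: 'X_[mon p i].

Definition bcoef (p : nat) (F : {mpoly A[2]}) (i : 'I_p.+1) : A := F@_(mon p i).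

End Forms.

Definition linform {A : comNzRingType} (l : A * A) : {mpoly A[2]} :=
  bracket ('X_ord0, 'X_ord_max) (l.1%:MP, l.2%:MP).

Definition quintic {A : comNzRingType} (l : 'I_5 -> A * A) : {mpoly A[2]} :=
  \prod_(j < 5) linform (l j).

Definition quartic {A : comNzRingType} (l : 'I_5 -> A * A) (i : 'I_5) :
    {mpoly A[2]} :=
  \prod_(j < 5 | j != i) linform (l j).

Section Invariants.
Context {K : fieldType}.

Definition gl_act (g : 'M[K]_2) (F : {mpoly K[2]}) : {mpoly K[2]} :=
  F \mPo [tuple \sum_(j < 2) invmx g i j *: 'X_j | i < 2].

(* bcoef (gl_act g (bform a)) is the coefficient vector of gF when a is that
   of F; over an infinite field, the identity at all points a is the identity
   of polynomials in the coefficients. *)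
Definition is_invariant (p d : nat) (I : {mpoly K[p.+1]}) : Prop :=
  I \is d.-homog /\
  exists w : int, forall g : 'M[K]_2, g \in unitmx ->
    forall a : 'I_p.+1 -> K,
      I.@[bcoef (gl_act g (bform a))] = (\det g) ^ (- w) * I.@[a].

(* Coefficients q_i of a quartic normalised by the binomials 'C(4, i). *)
Definition qcoef (Q : {mpoly K[2]}) (i : 'I_5) : K :=
  bcoef (p := 4) Q i / 'C(4, i)%:R.

Definition quarticS (Q : {mpoly K[2]}) : K :=
  let q k := qcoef Q (inord k) in
  q 0%N * q 4%N - 4%:R * q 1%N * q 3%N + 3%:R * q 2%N ^+ 2.

Definition quarticT (Q : {mpoly K[2]}) : K :=
  let q k := qcoef Q (inord k) in
  q 0%N * q 2%N * q 4%N + 2%:R * q 1%N * q 2%N * q 3%N - q 2%N ^+ 3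
    - q 0%N * q 3%N ^+ 2 - q 1%N ^+ 2 * q 4%N.

(* The polynomial in z attached to the homogeneous roots l of the quintic;
   'X is z, and calB_i is its coefficient of 'X^(5 - i). *)
Definition calB_poly (l : 'I_5 -> K * K) : {poly K} :=
  \prod_(i < 5)
    ((quarticS (quartic l i) ^+ 3 - 27%:R * quarticT (quartic l i) ^+ 2) *: 'X
       - (quarticS (quartic l i) ^+ 3)%:P).

End Invariants.

(* The coefficients of calB_poly l are polynomials in the coefficients of the
   quintic with roots l. S0 = 12 S and T0 = 432 T are free of denominators, so
   that zint = 6912^5 calB_poly makes sense over any commutative ring. With
   l_j = (r_j, 1), its coefficients are symmetric polynomials in the r_j of
   degree at most 24 in each; these are polynomials of degree at most 24 in the
   elementary symmetric polynomials, hence homogenise to degree 24. *)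

Definition S0 {A : comNzRingType} (Q : {mpoly A[2]}) : A :=
  let c k := bcoef (p := 4) Q (inord k) in
  12%:R * c 0%N * c 4%N - 3%:R * c 1%N * c 3%N + c 2%N * c 2%N.

Definition T0 {A : comNzRingType} (Q : {mpoly A[2]}) : A :=
  let c k := bcoef (p := 4) Q (inord k) in
  72%:R * c 0%N * c 2%N * c 4%N + 9%:R * c 1%N * c 2%N * c 3%N - 2%:R * c 2%N * c 2%N * c 2%N
    - 27%:R * c 0%N * c 3%N * c 3%N - 27%:R * c 1%N * c 1%N * c 4%N.

Definition zfac {A : comNzRingType} (Q : {mpoly A[2]}) : {poly A} :=
  (4%:R * S0 Q * S0 Q * S0 Q - T0 Q * T0 Q) *: 'X
    - (4%:R * S0 Q * S0 Q * S0 Q)%:P.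

Definition zint {A : comNzRingType} (l : 'I_5 -> A * A) : {poly A} :=
  \prod_(i < 5) zfac (quartic l i).

Lemma calB_polyE (K : numFieldType) (l : 'I_5 -> K * K) :
  calB_poly l = (6912%:R ^- 5) *: zint l.
Proof.
have nz (n : nat) : (n.+1)%:R != 0 :> K by rewrite pnatr_eq0.
rewrite /calB_poly /zint.
have -> : (6912%:R ^- 5) = \prod_(i < 5) (6912%:R^-1 : K).
  by rewrite prodr_const card_ord exprVn.
rewrite -scaler_prod; apply: eq_bigr => i _.
set Q := quartic l i; rewrite /zfac.
have qE k : (k <= 4)%N -> qcoef Q (inord k) = bcoef (p := 4) Q (inord k) / 'C(4, k)%:R.
  by move=> k4; rewrite /qcoef inordK.
have b0 : 'C(4, 0) = 1%N by [].
have b1 : 'C(4, 1) = 4%N by [].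
have b2 : 'C(4, 2) = 6%N by [].
have b3 : 'C(4, 3) = 4%N by [].
have b4 : 'C(4, 4) = 1%N by [].
have SE : quarticS Q = S0 Q / 12%:R.
  rewrite /quarticS /S0 !qE // b0 b1 b2 b3 b4.
  by do !move: (bcoef Q _) => ?; field; rewrite ?nz.
have TE : quarticT Q = T0 Q / 432%:R.
  rewrite /quarticT /T0 !qE // b0 b1 b2 b3 b4.
  by do !move: (bcoef Q _) => ?; field; rewrite ?nz.
rewrite SE TE scalerBr scalerA -mul_polyC -[_ *: _%:P]mul_polyC -polyCM -[in RHS]mul_polyC.
by congr (_%:P * _ - _%:P); field; rewrite ?nz.
Qed.

Section Morphism.
Variables (A B : comNzRingType) (f : {rmorphism A -> B}).

Lemma map_linform (l : A * A) :
  map_mpoly f (linform l) = linform (f l.1, f l.2).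
Proof.
by rewrite /linform /bracket /= rmorphB !rmorphM /= !map_mpolyX !map_mpolyC.
Qed.

Lemma rmorph_bcoef p (F : {mpoly A[2]}) i :
  f (bcoef (p := p) F i) = bcoef (map_mpoly f F) i.
Proof. by rewrite /bcoef mcoeff_map_mpoly. Qed.

Lemma map_quartic l i :
  map_mpoly f (quartic l i) = quartic (fun j => (f (l j).1, f (l j).2)) i.
Proof. by rewrite rmorph_prod; apply: eq_bigr => j _; exact: map_linform. Qed.

Lemma map_quintic l :
  map_mpoly f (quintic l) = quintic (fun j => (f (l j).1, f (l j).2)).
Proof. by rewrite rmorph_prod; apply: eq_bigr => j _; exact: map_linform. Qed.

Lemma rmorph_S0 Q : f (S0 Q) = S0 (map_mpoly f Q).
Proof.
rewrite /S0 -!rmorph_bcoef.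
move: (rmorph_nat f 12) (rmorph_nat f 3).
move: (12%:R : A) (12%:R : B) (3%:R : A) (3%:R : B) => ? ? ? ? <- <-.
do !move: (bcoef Q _) => ?.
by rewrite rmorphD rmorphB !rmorphM.
Qed.

Lemma rmorph_T0 Q : f (T0 Q) = T0 (map_mpoly f Q).
Proof.
rewrite /T0 -!rmorph_bcoef.
move: (rmorph_nat f 72) (rmorph_nat f 9) (rmorph_nat f 2) (rmorph_nat f 27).
move: (72%:R : A) (72%:R : B) (9%:R : A) (9%:R : B) => ? ? ? ? <- <-.
move: (2%:R : A) (2%:R : B) (27%:R : A) (27%:R : B) => ? ? ? ? <- <-.
do !move: (bcoef Q _) => ?.
by rewrite !rmorphB rmorphD !rmorphM.
Qed.

Lemma map_zint l :
  map_poly f (zint l) = zint (fun j => (f (l j).1, f (l j).2)).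
Proof.
rewrite rmorph_prod; apply: eq_bigr => i _; rewrite -map_quartic /zfac.
rewrite rmorphB /= map_polyZ map_polyX map_polyC /=.
by rewrite rmorphB !rmorphM rmorph_nat rmorph_S0 rmorph_T0.
Qed.

End Morphism.

Section Scale.
Variable A : comNzRingType.

Lemma linform_scale (c : A) (l : A * A) :
  linform (c * l.1, c * l.2) = c *: linform l.
Proof.
by rewrite /linform /bracket /= !mpolyCM -mul_mpolyC mulrBr; ring.
Qed.

Lemma quintic_scale (c : 'I_5 -> A) (l : 'I_5 -> A * A) :
  quintic (fun j => (c j * (l j).1, c j * (l j).2)) =
  (\prod_j c j) *: quintic l.
Proof.
by rewrite -scaler_prod; apply: eq_bigr => j _; rewrite linform_scale.
Qed.

Lemma quartic_scale (c : 'I_5 -> A) (l : 'I_5 -> A * A) i :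
  quartic (fun j => (c j * (l j).1, c j * (l j).2)) i =
  (\prod_(j | j != i) c j) *: quartic l i.
Proof.
by rewrite -scaler_prod; apply: eq_bigr => j _; rewrite linform_scale.
Qed.

Lemma zfac_scale (c : A) Q : zfac (c *: Q) = c ^+ 6 *: zfac Q.
Proof.
have bZ (i : 'I_5) : bcoef (p := 4) (c *: Q) i = c * bcoef (p := 4) Q i.
  by rewrite /bcoef mcoeffZ.
have SZ : S0 (c *: Q) = c ^+ 2 * S0 Q.
  by rewrite /S0 !bZ; do !move: (bcoef Q _) => ?; ring.
have TZ : T0 (c *: Q) = c ^+ 3 * T0 Q.
  by rewrite /T0 !bZ; do !move: (bcoef Q _) => ?; ring.
rewrite /zfac SZ TZ scalerBr scalerA -[c ^+ 6 *: _%:P]mul_polyC -polyCM.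
by move: (S0 Q) (T0 Q) => ? ?; congr (_ *: _ - _%:P); ring.
Qed.

Lemma zint_scale (c : 'I_5 -> A) (l : 'I_5 -> A * A) :
  zint (fun j => (c j * (l j).1, c j * (l j).2)) =
  (\prod_j c j) ^+ 24 *: zint l.
Proof.
rewrite /zint (eq_bigr (fun i => (\prod_(j | j != i) c j) ^+ 6 *: zfac (quartic l i))).
  2: by move=> i _; rewrite (quartic_scale c l) zfac_scale.
rewrite scaler_prod; congr (_ *: _).
rewrite prodrXl; have -> : 24%N = (4 * 6)%N by []; rewrite exprM; congr (_ ^+ _).
rewrite (exchange_big_dep xpredT) //= -prodrXl; apply: eq_bigr => j _.
rewrite prodr_const; congr (_ ^+ _).
by rewrite -[4%N]/(5.-1) -[in RHS](card_ord 5) -(cardC1 j); apply: eq_card => i; rewrite !inE eq_sym.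
Qed.

Lemma zint_perm (s : 'S_5) (l : 'I_5 -> A * A) : zint (l \o s) = zint l.
Proof.
rewrite /zint [RHS](reindex_inj (@perm_inj _ s)) /=.
apply: eq_bigr => i _; congr zfac.
rewrite /quartic [RHS](reindex_inj (@perm_inj _ s)) /=.
by apply: eq_bigl => j; rewrite (inj_eq perm_inj).
Qed.

Lemma eq_zint (l l' : 'I_5 -> A * A) : l =1 l' -> zint l = zint l'.
Proof.
move=> e; apply: eq_bigr => i _; congr zfac.
by apply: eq_bigr => j _; rewrite e.
Qed.

Lemma eq_quintic (l l' : 'I_5 -> A * A) : l =1 l' -> quintic l = quintic l'.
Proof. by move=> e; apply: eq_bigr => j _; rewrite e. Qed.

End Scale.

Section Filtration.
Variables (A : comNzRingType) (D : nat -> A -> Prop).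
Hypotheses (D0 : forall d, D d 0) (Dn : forall d n, D d n%:R)
  (DB : forall d x y, D d x -> D d y -> D d (x - y))
  (DM : forall d e x y, D d x -> D e y -> D (d + e) (x * y)).

Lemma filtD d x y : D d x -> D d y -> D d (x + y).
Proof.
move=> dx dy; rewrite -[y]opprK; apply: (DB dx).
by rewrite -[- y]add0r; apply: (DB).
Qed.

Lemma filt_sum d (I : Type) (r : seq I) (P : pred I) (F : I -> A) :
  (forall i, P i -> D d (F i)) -> D d (\sum_(i <- r | P i) F i).
Proof. by move=> h; apply: big_rec => // i x Pi; apply: filtD; apply: h. Qed.

Lemma filt_le d e x : (d <= e)%N -> D d x -> D e x.
Proof.
by move=> /subnKC <- dx; rewrite -[x]mulr1; apply: (DM dx); apply: (Dn _ 1).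
Qed.

Definition filt_form d (F : {mpoly A[2]}) := forall m, D d F@_m.
Definition filt_poly d (p : {poly A}) := forall k, D d p`_k.

Lemma filt_formM d e F G :
  filt_form d F -> filt_form e G -> filt_form (d + e) (F * G).
Proof. by move=> dF dG m; rewrite mcoeffM; apply: filt_sum => k _; apply: (DM). Qed.

Lemma filt_polyM d e p q :
  filt_poly d p -> filt_poly e q -> filt_poly (d + e) (p * q).
Proof. by move=> dF dG m; rewrite coefM; apply: filt_sum => k _; apply: (DM). Qed.

Lemma filt_form_prod (I : finType) (P : pred I) (d : I -> nat) F :
  (forall i, P i -> filt_form (d i) (F i)) ->
  filt_form (\sum_(i | P i) d i) (\prod_(i | P i) F i).
Proof.
move=> h; apply: (big_rec2 filt_form) => [m|i n G Pi]; last exact/filt_formM/h.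
by rewrite mcoeff1; apply: Dn.
Qed.

Lemma filt_poly_prod (I : finType) (P : pred I) (d : I -> nat) F :
  (forall i, P i -> filt_poly (d i) (F i)) ->
  filt_poly (\sum_(i | P i) d i) (\prod_(i | P i) F i).
Proof.
move=> h; apply: (big_rec2 filt_poly) => [m|i n G Pi]; last exact/filt_polyM/h.
by rewrite coef1; apply: Dn.
Qed.

Lemma filt_zfac d Q : filt_form d Q -> filt_poly (d * 6) (zfac Q).
Proof.
move=> dQ.
have C k : D d (bcoef (p := 4) Q (inord k)) by apply: dQ.
have X e n x : D e x -> D e (n%:R * x) by move=> ?; apply: (@DM 0 e).
have M e x y : D (d * e) x -> D d y -> D (d * e.+1) (x * y).
  by move=> ? ?; rewrite mulnS addnC; apply: (DM).
have C1 n k : D (d * 1) (n%:R * bcoef (p := 4) Q (inord k)).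
  by rewrite muln1; apply/X/C.
have C1' k : D (d * 1) (bcoef (p := 4) Q (inord k)) by rewrite muln1.
have SD : D (d * 2) (S0 Q).
  by rewrite /S0; apply: (filtD (DB _ _)); apply: (M).
have TD : D (d * 3) (T0 Q).
  have TM n i j k : D (d * 3) (n%:R * bcoef (p := 4) Q (inord i)
      * bcoef (p := 4) Q (inord j) * bcoef (p := 4) Q (inord k)).
    by apply: (M); [apply: (M)|].
  rewrite /T0; apply: (DB (DB (DB (filtD _ _) _) _) _); exact: TM.
have E1 : D (d * 6) (4%:R * S0 Q * S0 Q * S0 Q).
  have -> : (d * 6 = 0 + d * 2 + d * 2 + d * 2)%N by rewrite -!mulnDr.
  by do !apply: (DM).
have E2 : D (d * 6) (T0 Q * T0 Q).
  have -> : (d * 6 = d * 3 + d * 3)%N by rewrite -!mulnDr.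
  by apply: (DM).
move=> k; rewrite /zfac coefB coefZ coefX coefC; apply: (DB).
  case: eqP => _; first by rewrite mulr1; apply: (DB).
  by rewrite mulr0.
by case: ifP.
Qed.

Lemma filt_zint (l : 'I_5 -> A * A) :
  (forall j, D (j == ord0) (l j).1) -> (forall j, D (j == ord0) (l j).2) ->
  filt_poly 24 (zint l).
Proof.
move=> h1 h2.
have L j : filt_form (j == ord0) (linform (l j)).
  move=> m; rewrite /linform /bracket /= mcoeffB ![_ * _%:MP]mulrC !mcoeffCM.
  have MX d x (n : nat) : D d x -> D d (x * n%:R).
    by move=> dx; rewrite -[d]addn0; apply: (DM).
  by rewrite !mcoeffX; apply: (DB); apply: (MX).
have -> : (24 = \sum_(i < 5) (\sum_(j < 5 | j != i) (j == ord0)) * 6)%N.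
  rewrite (eq_bigr (fun i : 'I_5 => (i != ord0) * 6)%N) => [|i _].
    by rewrite !big_ord_recl big_ord0.
  congr (_ * _)%N; rewrite big_mkcond !big_ord_recl big_ord0.
  by case: i => [[|[|[|[|[|?]]]]] ?].
by apply: filt_poly_prod => i _; apply/filt_zfac/filt_form_prod.
Qed.

End Filtration.

Section SymDegree.
Variable K : comNzRingType.

Definition deg0 n (d : nat) (p : {mpoly K[n.+1]}) : Prop :=
  forall m : 'X_{1..n.+1}, (d < m ord0)%N -> p@_m = 0.

Section Deg0.
Variable n : nat.
Implicit Types p q : {mpoly K[n.+1]}.

Lemma deg0_0 d : deg0 d (0 : {mpoly K[n.+1]}).
Proof. by move=> m _; rewrite mcoeff0. Qed.

Lemma deg0_nat d k : deg0 d (k%:R : {mpoly K[n.+1]}).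
Proof.
move=> m lt_dm; rewrite mcoeffMn mcoeff1; case: eqP lt_dm => [->|].
  by rewrite mnm0E.
by rewrite mul0rn.
Qed.

Lemma deg0B d p q : deg0 d p -> deg0 d q -> deg0 d (p - q).
Proof. by move=> dp dq m h; rewrite mcoeffB dp // dq // subr0. Qed.

Lemma deg0M d e p q : deg0 d p -> deg0 e q -> deg0 (d + e) (p * q).
Proof.
move=> dp dq m h; rewrite mcoeffM big1 // => -[k1 k2] /= /eqP /(congr1 (fun m : 'X_{1..n.+1} => m ord0)) mE.
have [le1|lt1] := leqP (k1 ord0) d; last by rewrite dp // mul0r.
have [le2|lt2] := leqP (k2 ord0) e; last by rewrite dq // mulr0.
by move: h; rewrite mE /= mnmDE ltnNge leq_add.
Qed.

Lemma deg0Z d c p : deg0 d p -> deg0 d (c *: p).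
Proof. by move=> dp m h; rewrite mcoeffZ dp // mulr0. Qed.

Lemma deg0_mesym k : deg0 1 (mesym n.+1 K k).
Proof.
move=> m h; rewrite mesymE raddf_sum /= big1 // => s _.
rewrite mcoeffX; case: eqP => // e; move: h; rewrite -e mnmE.
by case: (_ \in _).
Qed.

Lemma deg0_Xn d p k : deg0 d p -> deg0 (d * k) (p ^+ k).
Proof.
move=> dp; elim: k => [|k IHk]; first by rewrite muln0; apply: (@deg0_nat 0 1).
by rewrite mulnS exprS; apply: deg0M.
Qed.

Lemma deg0_prod (I : finType) (d : I -> nat) (F : I -> {mpoly K[n.+1]}) :
  (forall i, deg0 (d i) (F i)) -> deg0 (\sum_i d i) (\prod_i F i).
Proof.
move=> h; apply: (big_rec2 (@deg0 n)) => [|i k G _]; last exact: deg0M.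
exact: (@deg0_nat 0 1).
Qed.

End Deg0.

Lemma sym_deg0 n d (p : {mpoly K[n.+1]}) : p \is symmetric -> deg0 d p ->
  exists2 t : {mpoly K[n.+1]},
    p = t \mPo [tuple mesym n.+1 K i.+1 | i < n.+1]
    & forall m, m \in msupp t -> (mdeg m <= d)%N.
Proof.
elim/mleadrect: p => p IHp sym_p dp.
have [->|nz_p] := eqVneq p 0.
  by exists 0; [rewrite comp_mpoly0|move=> m; rewrite msupp0].
have /and3P[] := symf1P sym_p; set q := (symf1 p).2.
have le_md : (mlead p ord0 <= d)%N.
  rewrite leqNgt; apply/negP => /dp /eqP.
  by rewrite mleadc_eq0 (negPf nz_p).
pose F (i : 'I_n.+1) := (nth 0 (mlead p) i - nth 0 (mlead p) i.+1)%N.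
have F1 : (symf1 p).1 = p@_(mlead p) *: 'X_[[multinom F i | i < n.+1]].
  by rewrite /symf1 (negPf nz_p).
have degF : (\sum_i F i)%N = mlead p ord0.
  pose G i := nth 0%N (mlead p) i.
  have Gn : G n.+1 = 0%N by rewrite /G nth_default // size_tuple.
  have := mlead_msym_sorted sym_p.
  have -> : mlead p ord0 = (G 0 - G n.+1)%N by rewrite Gn subn0 /G (mnm_nth 0%N).
  move=> srt; rewrite /F -(big_mkord xpredT (fun i => G i - G i.+1)%N).
  rewrite ssrcomplements.sum0n_range // => i j /andP[ij]; rewrite ltnS leq_eqVlt => /predU1P[->|jn].
    by rewrite Gn.
  have iin : (i < n.+1)%N by apply: leq_ltn_trans jn.
  by have := srt (Ordinal iin) (Ordinal jn) ij; rewrite !(mnm_nth 0%N).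
move=> lead_q sym_q /eqP pE.
have dq : deg0 d q.
  have -> : q = p - ((symf1 p).1 \mPo [tuple mesym n.+1 K i.+1 | i < n.+1]).
    by apply/eqP; rewrite eq_sym subr_eq addrC -pE.
  apply: deg0B => //; rewrite F1 comp_mpolyZ comp_mpolyX; apply: deg0Z.
  have le_d m (x : {mpoly K[n.+1]}) : (m <= d)%N -> deg0 m x -> deg0 d x.
    by move=> le_m dx k ?; apply: dx; apply: leq_ltn_trans le_m _.
  apply: le_d le_md _; rewrite -degF; apply: deg0_prod => i.
  by rewrite tnth_mktuple mnmE; have := @deg0_Xn n 1 _ (F i) (@deg0_mesym n i.+1); rewrite mul1n.
have [t qE dt] : exists2 t : {mpoly K[n.+1]},
    q = t \mPo [tuple mesym n.+1 K i.+1 | i < n.+1]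
    & forall m, m \in msupp t -> (mdeg m <= d)%N.
  have [->|nz_q] := eqVneq q 0.
    by exists 0; [rewrite comp_mpoly0|move=> m; rewrite msupp0].
  by apply: IHp => //; move: lead_q; rewrite (negPf nz_q).
exists ((symf1 p).1 + t).
  by rewrite raddfD /= -qE.
move=> m /msuppD_le; rewrite mem_cat => /orP[|/dt //].
rewrite F1 => /msuppZ_le; rewrite msuppX inE => /eqP ->.
rewrite mdegE (eq_bigr F) ?degF // => i _; by rewrite mnmE.
Qed.

End SymDegree.

Lemma mon0 p i : mon p i ord0 = (p - i)%N.
Proof. by rewrite /mon mnmDE !mulmnE !mnm1E /= mul1n mul0n addn0. Qed.

Lemma mon1 p i : mon p i ord_max = i.
Proof. by rewrite /mon mnmDE !mulmnE !mnm1E /= mul1n mul0n add0n. Qed.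

Lemma mnm2P (m m' : 'X_{1..2}) :
  m ord0 = m' ord0 -> m ord_max = m' ord_max -> m = m'.
Proof.
move=> e0 e1; apply/mnmP => -[[|[|//]] lt_i2].
- by rewrite (_ : Ordinal lt_i2 = ord0) //; apply: val_inj.
- by rewrite (_ : Ordinal lt_i2 = ord_max) //; apply: val_inj.
Qed.

Section Dehom.
Variable K : fieldType.

Let h (i : 'I_2) : {poly K} := if i == ord0 then 'X else 1.
Let phi : {mpoly K[2]} -> {poly K} := mmap polyC h.

Lemma quintic_bcoef (r : 'I_5 -> K) (i : 'I_6) :
  bcoef (p := 5) (quintic (fun j => (r j, 1))) i =
  (-1) ^+ i * (mesym 5 K i).@[r].
Proof.
set F := quintic _.
have hF : F \is 5.-homog.
  rewrite (_ : 5%N = \sum_(j < 5) 1)%N; last by rewrite sum_nat_const card_ord.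
  rewrite /F /quintic; apply: (big_rec2 (fun d (G : {mpoly K[2]}) => G \is d.-homog)).
    by rewrite dhomog1.
  move=> j d G _ hG; apply: dhomogM => //.
  by rewrite /linform /bracket /= ![_ * _%:MP]mulrC !mul_mpolyC;
    apply: rpredB; apply: rpredZ; rewrite dhomogX /= mdeg1.
have -> : bcoef (p := 5) F i = (phi F)`_(5 - i).
  rewrite /phi /mmap coef_sum /bcoef.
  have E (m : 'X_{1..2}) : m \in msupp F ->
      ((F@_m)%:P * mmap1 h m)`_(5 - i) = if m == mon 5 i then F@_m else 0.
    move=> /(dhomog_mf hF) /= dm.
    have -> : mmap1 h m = 'X^(m ord0).
      rewrite /mmap1 !big_ord_recl big_ord0 /h /= expr1n !mulr1.
      by congr ('X^(m _)); apply: val_inj.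
    rewrite coefCM coefXn.
    have dm' : (m ord0 + m ord_max = 5)%N.
      rewrite -dm mdegE !big_ord_recl big_ord0 addn0; congr (m _ + m _)%N; exact: val_inj.
    case: eqP => [e|ne].
      rewrite (_ : m = mon 5 i) ?eqxx ?mulr1 //.
      apply: mnm2P; rewrite ?mon0 ?mon1 -?e //.
      have := ltn_ord i; rewrite ltnS => i5.
      by apply/eqP; rewrite -(eqn_add2l (m ord0)) dm' -e subnK.
    case: eqP => [e|]; last by rewrite mulr0.
    by case: ne; rewrite e mon0.
  rewrite (eq_big_seq _ E).
  have [min|mout] := boolP (mon 5 i \in msupp F).
    rewrite (bigD1_seq (mon 5 i)) //= eqxx big1 ?addr0 // => m.
    by move=> /negPf ->.
  rewrite (memN_msupp_eq0 mout) big1_seq // => m /= mF.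
  by case: eqP mF => // ->; rewrite (negPf mout).
have -> : phi F = \prod_(c <- [tuple r j | j < 5]) ('X - c%:P).
  rewrite big_tuple /F /phi rmorph_prod /=; apply: eq_bigr => j _.
  rewrite tnth_mktuple /linform /bracket /= rmorphB !rmorphM /= !mmapX !mmap1U.
  by rewrite !mmapC /h /= mulr1 mul1r.
rewrite mroots_coeff; congr (_ * _); apply: meval_eq => j.
by rewrite tnth_mktuple.
Qed.

End Dehom.

Section CalBExists.
Variable K : numFieldType.

Lemma poly_eq0_eval (p : {poly K}) : (forall x, p.[x] = 0) -> p = 0.
Proof.
move=> p0; apply/eqP/negPn/negP => nz_p.
pose s := [seq i%:R : K | i <- iota 0 (size p)].
have := max_poly_roots (rs := s) nz_p; rewrite size_map size_iota ltnn => H.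
suff: false by []. apply: H.
  by apply/allP => x _; rewrite rootE p0.
rewrite map_inj_uniq ?iota_uniq //.
by move=> i j /eqP; rewrite eqr_nat => /eqP.
Qed.

Lemma zint_poly (k : 'I_6) : exists B : {mpoly K[6]},
  forall l : 'I_5 -> K * K, (forall j, (l j).2 != 0) ->
    B.@[bcoef (quintic l)] = (zint l)`_(5 - k).
Proof.
pose lX (j : 'I_5) : {mpoly K[5]} * {mpoly K[5]} := ('X_j, 1).
pose p := (zint lX)`_(5 - k).
have sym_p : p \is symmetric.
  apply/issymP => s; rewrite /p -coef_map map_zint -[in RHS](zint_perm s lX).
  have E : (fun j => (msym s (lX j).1, msym s (lX j).2)) =1 lX \o s.
    move=> j; rewrite /lX /= rmorph1 msymX; congr ('X_[_], _).
    apply/mnmP => i.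
    by rewrite mnmE !mnm1E -(inj_eq (@perm_inj _ s)) permKV.
  by rewrite (eq_zint E).
have deg_p : deg0 24 p.
  apply: (@filt_zint _ (@deg0 K 4)).
  - exact: deg0_0.
  - exact: deg0_nat.
  - exact: deg0B.
  - exact: deg0M.
  - move=> j m; rewrite /= mcoeffX; have [<-|//] := eqVneq U_(j)%MM m.
    by rewrite mnm1E ltnn.
  - by move=> j; apply: (@deg0_nat _ _ _ 1).
have [t pE degt] := sym_deg0 sym_p deg_p.
pose B : {mpoly K[6]} := \sum_(m <- msupp t) t@_m *:
  ('X_ord0 ^+ (24 - mdeg m) *
   \prod_(i < 5) ((-1) ^+ i.+1 *: 'X_(lift ord0 i)) ^+ m i).
exists B => l nz_l.
pose r j := (l j).1 / (l j).2; pose C := \prod_j (l j).2.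
have lE : l =1 (fun j => ((l j).2 * r j, (l j).2 * 1)).
  move=> j; rewrite /r mulr1 mulrC divfK //; by case: (l j).
have zE : (zint l)`_(5 - k) = C ^+ 24 * p.@[r].
  rewrite (eq_zint lE) (zint_scale (fun j => (l j).2) (fun j => (r j, 1))) coefZ.
  rewrite /p -(coef_map (meval r)) map_zint /=.
  have E : (fun j => (meval r (lX j).1, meval r (lX j).2)) =1 (fun j => (r j, 1)).
    by move=> j; rewrite /= mevalXU rmorph1.
  by rewrite (eq_zint E).
have aE (i : 'I_6) : bcoef (quintic l) i = C * ((-1) ^+ i * (mesym 5 K i).@[r]).
  rewrite (eq_quintic lE) (quintic_scale (fun j => (l j).2) (fun j => (r j, 1))).
  by rewrite /bcoef mcoeffZ -quintic_bcoef.
rewrite zE pE comp_mpoly_meval [X in _ * X]mevalE mulr_sumr raddf_sum /=.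
apply: eq_big_seq => m /degt le_m.
rewrite mevalZ mevalM rmorphXn /= mevalXU aE expr0 mul1r mesym0E meval1 mulr1.
rewrite [RHS]mulrCA; congr (_ * _).
rewrite rmorph_prod /= (eq_bigr (fun i : 'I_5 => C ^+ m i *
   ((tnth [tuple mesym 5 K i.+1 | i < 5] i).@[r]) ^+ m i)); last first.
  move=> i _; rewrite rmorphXn /= mevalZ mevalXU aE tnth_mktuple -exprMn.
  by rewrite lift0 mulrCA signrMK.
rewrite big_split /= mulrA; congr (_ * _).
by rewrite -expr_sum -mdegE -exprD subnK.
Qed.

Lemma calB_exists (k : 'I_6) : exists B : {mpoly K[6]},
  forall l : 'I_5 -> K * K,
    B.@[bcoef (quintic l)] = (calB_poly l)`_(5 - k).
Proof.
have [B hB] := zint_poly k.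
exists (6912%:R ^- 5 *: B) => l; rewrite mevalZ calB_polyE coefZ; congr (_ * _).
pose lX j : {poly K} * {poly K} := ((l j).1%:P, (l j).2%:P + 'X).
pose P1 := (zint lX)`_(5 - k).
pose P2 : {poly K} := mmap polyC (bcoef (quintic lX)) B.
pose ls s j := ((l j).1, (l j).2 + s).
have lsE s j : (horner_eval s (lX j).1, horner_eval s (lX j).2) = ls s j.
  by rewrite /lX /ls /= /horner_eval !hornerE.
have e1 s : P1.[s] = (zint (ls s))`_(5 - k).
  rewrite -[_.[s]]/(horner_eval s P1) /P1 -coef_map map_zint.
  by rewrite (eq_zint (lsE s)).
have e2 s : P2.[s] = B.@[bcoef (quintic (ls s))].
  rewrite -[_.[s]]/(horner_eval s P2) /P2 mevalE /mmap raddf_sum /=.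
  apply: eq_bigr => m _; rewrite rmorphM /= /horner_eval hornerC; congr (_ * _).
  rewrite -[_.[s]]/(horner_eval s _) rmorph_prod; apply: eq_bigr => i _.
  rewrite rmorphXn /= rmorph_bcoef map_quintic; by rewrite (eq_quintic (lsE s)).
have P0 : (P2 - P1) * \prod_j ((l j).2%:P + 'X) = 0.
  apply: poly_eq0_eval => s; rewrite hornerM horner_prod hornerD hornerN e1 e2.
  have [/forallP nz|/forallPn[j]] := boolP [forall j, (l j).2 + s != 0].
    by rewrite hB ?subrr ?mul0r.
  rewrite negbK => /eqP e.
  by rewrite (bigD1 j) //= hornerD hornerC hornerX e mul0r mulr0.
have /eqP : P2 = P1.
  apply/eqP; rewrite -subr_eq0; move/eqP: P0; rewrite mulf_eq0 => /orP[//|].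
  rewrite prodf_seq_eq0 => /hasP[j _] /=.
  by rewrite addrC -[(l j).2]opprK polyCN polyXsubC_eq0.
move=> /eqP /(congr1 (horner^~ 0)); rewrite e1 e2.
have l0 : ls 0 =1 l by move=> j; rewrite /ls addr0; case: (l j).
by rewrite (eq_quintic l0) (eq_zint l0).
Qed.

End CalBExists.

Section CalB.
Variable R : realType.

(* calB k is the polynomial function of the coefficients of F given by calBP.
   As every binary quintic over R[i] splits into linear forms, calBP determines
   it. *)
Definition calB (k : 'I_6) : {mpoly R[i][6]} := sval (cid (calB_exists R[i] k)).

Lemma calBP (k : 'I_6) (l : 'I_5 -> R[i] * R[i]) :
  (calB k).@[bcoef (quintic l)] = (calB_poly l)`_(5 - k).
Proof. exact: (svalP (cid (calB_exists R[i] k))). Qed.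

End CalB.

(* Main.v *)
(* A general binary quintic is a sum of fifth powers of three linear forms with
   sum zero and pairwise determinants 1 (Sylvester), the apolar cubic covariant
   supplying the three forms. On these normal forms a u^5 + b v^5 + c w^5 an
   invariant J of degree d divisible by 4 is a symmetric polynomial in a, b, c,
   and I4 = s2^2 - 4 s1 s3, I8 = s3^2 s2, I12 = s3^4 in the elementary symmetric
   functions. Solving for s1 and s2 makes I12^M J a polynomial in I4, I8, I12;
   as I4 and I8 remain independent on {I12 = 0}, so is J itself.

   Hence the B_k are combinations of the seven monomials of weight 6 in
   I4, I8, I12 (weights 1, 2, 3), and their coefficients are determined by the
   values at seven quintics with rational roots. The B_k span a hyperplane W of
   that seven-dimensional space, spanned by elements m + c I12^2 with m one of
   the other six monomials; W does not contain I12^2, but W W contains the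
   products of any two monomials of weight 6. Every monomial of weight divisible
   by 12 is a product of such pairs. *)
Require Import Defs.
From HB Require Import structures.
From mathcomp Require Import all_boot all_order all_fingroup all_algebra.
From mathcomp Require Import boolp reals complex.
From mathcomp Require Import mpoly.
From mathcomp Require Import ring zify.

Set Implicit Arguments.
Unset Strict Implicit.
Unset Printing Implicit Defensive.

Import GRing.Theory Num.Theory.
Local Open Scope ring_scope.

(** * Polynomials as functions *)

(** Divisibility of the degree by 4 makes the restriction to the normal forms symmetric: odd
    permutations of the three linear forms come from substitutions of determinant -1. The classical
    invariant of degree 18 restricts to an alternating function instead. Inverting [I12] costs
    nothing on a dense set, since a canonizant with distinct roots is what the normal form requires.
    The obstacle on the side of the B_k is size: they are not expanded in the coefficients of the
    quintic. Knowing that they lie in a space of dimension seven reduces their computation to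
    evaluating brackets of explicit roots. The scalings 2^7 and 2^11 are such that y = x^2 on
    quintics with a double root, and also z = x^3 on those with two double roots, so the
    coefficients of a weight 6 form simply add up there. Six invariants cannot span the seven
    monomials of degree 24, so degree 24 itself is out of reach and products of two are needed; this
    is the source of 48. *)

Section MPolyEval.
Variable K : numFieldType.

(** Uniqueness of base [N] expansions; it keeps distinct monomials apart under the Kronecker
    substitution. *)
Lemma foldr_digits_inj (N : nat) (s t : seq nat) :
  size s = size t -> all (fun d => d < N)%N s -> all (fun d => d < N)%N t ->
  foldr (fun d a => d + N * a)%N 0%N s = foldr (fun d a => d + N * a)%N 0%N t ->
  s = t.
Proof.
elim: s t => [|d s IHs] [|e t] //= [sz] /andP[dN sN] /andP[eN tN] E.
have N0 : (0 < N)%N by apply: leq_ltn_trans dN.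
have de : d = e by have := congr1 (modn^~ N) E; rewrite /= ![(_ + N * _)%N]addnC ![(N *
    _)%N]mulnC !modnMDl !modn_small.
move: E; rewrite de => /eqP; rewrite eqn_add2l eqn_pmul2l // => /eqP E.
by rewrite (IHs t).
Qed.

(* Kronecker substitution [X_i := x ^ (N ^ i)] reduces this to one variable. *)
Lemma mpoly_eq0_meval n (p : {mpoly K[n]}) : (forall v, p.@[v] = 0) -> p = 0.
Proof.
move=> p0; pose N := msize p.
pose code (m : 'X_{1..n}) := foldr (fun d a => d + N * a)%N 0%N m.
have codeE m : code m = (\sum_(i < n) m i * N ^ i)%N.
  have digits (s : seq nat) : foldr (fun d a => d + N * a)%N 0%N s
      = (\sum_(i < size s) nth 0 s i * N ^ i)%N.
    elim: s => [|d s IHs] /=; first by rewrite big_ord0.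
    rewrite big_ord_recl /= expn0 muln1 IHs big_distrr; congr (_ + _)%N.
    by apply: eq_bigr => i _; rewrite /= expnS mulnCA.
  rewrite /code digits size_tuple; apply: eq_bigr => i _.
  by rewrite (mnm_nth 0%N).
have code_inj : {in msupp p &, injective code}.
  have ltN m : m \in msupp p -> all (fun d => d < N)%N m.
    move=> mp; apply/(all_nthP 0%N) => i; rewrite size_tuple => lt_in.
    apply: leq_ltn_trans (msize_mdeg_lt mp).
    have -> : nth 0%N m i = m (Ordinal lt_in) by rewrite (mnm_nth 0%N).
    rewrite mdegE.
    by rewrite (bigD1 (Ordinal lt_in)) //= leq_addr.
  move=> m m' mp m'p E; apply/val_inj/val_inj.
  by apply: foldr_digits_inj E; rewrite ?size_tuple //; apply: ltN.
pose q : {poly K} := \sum_(m <- msupp p) p@_m *: 'X^(code m).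
have q0 : q = 0.
  apply: poly_eq0_eval => x; rewrite horner_sum -[RHS](p0 (fun i => x ^+ (N ^ i))).
  rewrite mevalE; apply: eq_bigr => m _; rewrite !hornerE codeE expr_sum.
  by congr (_ * _); apply: eq_bigr => i _; rewrite -exprM mulnC.
apply/mpolyP => m; rewrite mcoeff0.
have [mp|] := boolP (m \in msupp p); last exact: memN_msupp_eq0.
have := congr1 (fun r : {poly K} => r`_(code m)) q0.
rewrite coef0 coef_sum (bigD1_seq m) //= big1_seq ?addr0.
  by rewrite coefZ coefXn eqxx mulr1.
move=> m' /andP[ne m'p]; rewrite coefZ coefXn.
case: eqP => [E|]; last by rewrite mulr0.
by rewrite (code_inj _ _ mp m'p E) eqxx in ne.
Qed.

(** The product [D * (p - q)] vanishes everywhere and the ring is a domain. Identities thus need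
    checking only on generic quintics: those with a normal form, or those given by explicit
    roots. *)
Lemma mpoly_eq_dense n (D p q : {mpoly K[n]}) : D != 0 ->
  (forall v, D.@[v] != 0 -> p.@[v] = q.@[v]) -> p = q.
Proof.
move=> nzD pq; apply/eqP; rewrite -subr_eq0.
suff /eqP: D * (p - q) = 0 by rewrite mulf_eq0 (negPf nzD).
apply: mpoly_eq0_meval => v; rewrite mevalM mevalB.
have [->|/pq ->] := eqVneq D.@[v] 0; first by rewrite mul0r.
by rewrite subrr mulr0.
Qed.

Lemma mpoly_eq_meval n (p q : {mpoly K[n]}) :
  (forall v, p.@[v] = q.@[v]) -> p = q.
Proof. by move=> pq; apply: (@mpoly_eq_dense _ 1); rewrite ?oner_eq0. Qed.

Lemma meval_dhomog n d (p : {mpoly K[n]}) c v : p \is d.-homog ->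
  p.@[fun i => c * v i] = c ^+ d * p.@[v].
Proof.
move=> hp; rewrite !mevalE mulr_sumr; apply: eq_big_seq => m mp.
rewrite mulrCA -(dhomog_mf hp mp) /= mdegE expr_sum -big_split /=.
by congr (_ * _); apply: eq_bigr => i _; rewrite exprMn.
Qed.

(** A single scaling suffices: the powers of 2 are distinct in characteristic zero, so the factor
    2^d on each coefficient determines the degree of its monomial. *)
Lemma dhomog_meval n d (p : {mpoly K[n]}) :
  (forall v, p.@[fun i => 2 * v i] = 2 ^+ d * p.@[v]) -> p \is d.-homog.
Proof.
move=> hp; apply/dhomogP => m mp /=.
pose q : {mpoly K[n]} := \sum_(m <- msupp p) (2 ^+ mdeg m * p@_m) *: 'X_[m].
have qE : q = 2 ^+ d *: p.
  apply: mpoly_eq_meval => v; rewrite mevalZ -hp raddf_sum mevalE.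
  apply: eq_bigr => k _; rewrite /= mevalZ mevalX -mulrA mulrCA; congr (_ * _).
  rewrite mdegE expr_sum -big_split /=; by apply: eq_bigr => i _; rewrite exprMn.
have := congr1 (mcoeff m) qE; rewrite mcoeffZ raddf_sum (bigD1_seq m) //= big1.
  rewrite addr0 mcoeffZ mcoeffX eqxx mulr1 => /mulIf.
  rewrite mcoeff_eq0 mp => /(_ isT) /ieexprIn; apply; first exact: ltr0n.
  by rewrite -subr_eq0 -[1]/(1%:R) -natrB ?oner_eq0.
by move=> k ne; rewrite mcoeffZ mcoeffX (negPf ne) mulr0.
Qed.

(** Substituting elements of degrees [w i] turns a monomial into a homogeneous element, so
    projecting onto degree [d] discards the terms of wrong weight without changing [p]. *)
Lemma comp_mpoly_dhomog n m d (w : 'I_n -> nat) (T : n.-tuple {mpoly K[m]})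
    (p : {mpoly K[m]}) (t : {mpoly K[n]}) :
  (forall i, tnth T i \is (w i).-homog) -> p \is d.-homog -> p = t \mPo T ->
  exists2 t' : {mpoly K[n]}, p = t' \mPo T &
    forall k, k \in msupp t' -> (\sum_i w i * k i)%N = d.
Proof.
move=> hT hp pE; pose wt (k : 'X_{1..n}) := (\sum_i w i * k i)%N.
have hX (k : 'X_{1..n}) : 'X_[k] \mPo T \is (wt k).-homog.
  rewrite comp_mpolyX /wt.
  apply: (big_rec2 (fun e (q : {mpoly K[m]}) => q \is e.-homog)) => [|i e q _ hq].
    exact: dhomog1.
  by apply: dhomogM => //; apply: dhomogMn.
exists (\sum_(k <- msupp t | wt k == d) t@_k *: 'X_[k]).
  rewrite -[p](pihomog_dE hp) {1}pE comp_mpolyEX !raddf_sum big_mkcond /=.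
  rewrite [RHS]big_mkcond; apply: eq_bigr => k _; rewrite linearZ /= comp_mpolyZ.
  case: eqP => [e|/eqP ne]; first by rewrite pihomog_dE // -e.
  by rewrite (pihomog_ne0 ne) ?scaler0.
move=> k /msupp_sum_le /flatten_mapP[k']; rewrite mem_filter => /andP[/eqP wk' _].
by move=> /msuppZ_le; rewrite msuppX inE => /eqP ->.
Qed.

End MPolyEval.

(** * Binary forms and sums of fifth powers *)

Section BinaryForms.
Variable K : fieldType.
Implicit Types (u v : K * K) (g h : 'M[K]_2).

Lemma bcoef_bform p (a : 'I_p.+1 -> K) : bcoef (bform a) =1 a.
Proof.
move=> i; rewrite /bcoef /bform raddf_sum (bigD1 i) //= mcoeffZ mcoeffX eqxx mulr1.
rewrite big1 ?addr0 // => j ne; rewrite mcoeffZ mcoeffX; case: eqP => [e|]; last by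
    rewrite mulr0.
by case/eqP: ne; apply: val_inj; have := congr1 (fun m : 'X_{1..2} => m ord_max) e;
    rewrite /= !mon1.
Qed.

Definition lin v : {mpoly K[2]} := v.1 *: 'X_ord0 + v.2 *: 'X_ord_max.

Definition vmulmx v h : K * K :=
  (v.1 * h ord0 ord0 + v.2 * h ord_max ord0,
   v.1 * h ord0 ord_max + v.2 * h ord_max ord_max).

Lemma sum_I2 (V : nmodType) (F : 'I_2 -> V) : \sum_i F i = F ord0 + F ord_max.
Proof. by rewrite big_ord_recr big_ord1; congr (F _ + _); apply: val_inj. Qed.

Lemma gl_act_lin g v : gl_act g (lin v) = lin (vmulmx v (invmx g)).
Proof.
rewrite /gl_act /lin comp_mpolyD !comp_mpolyZ !comp_mpolyXU -!tnth_nth.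
rewrite !tnth_mktuple !sum_I2 /vmulmx /= !scalerDr !scalerDl !scalerA.
by rewrite addrACA.
Qed.

Lemma gl_actZ g c F : gl_act g (c *: F) = c *: gl_act g F.
Proof. exact: comp_mpolyZ. Qed.

Lemma gl_act_sum g (I : Type) (r : seq I) (P : pred I) (F : I -> {mpoly K[2]}) :
  gl_act g (\sum_(i <- r | P i) F i) = \sum_(i <- r | P i) gl_act g (F i).
Proof. exact: raddf_sum. Qed.

Lemma gl_actX g F n : gl_act g (F ^+ n) = gl_act g F ^+ n.
Proof. exact: rmorphXn. Qed.

Lemma gl_act_prod g (I : Type) (r : seq I) (P : pred I) (F : I -> {mpoly K[2]}) :
  gl_act g (\prod_(i <- r | P i) F i) = \prod_(i <- r | P i) gl_act g (F i).
Proof. exact: rmorph_prod. Qed.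

(* Coefficients of the sum of the [c_j (x_1 v_j.1 + x_2 v_j.2)^5]. *)
Definition powsum (c : 'I_3 -> K) (v : 'I_3 -> K * K) (i : 'I_6) : K :=
  'C(5, i)%:R * \sum_j c j * ((v j).1 ^+ (5 - i) * (v j).2 ^+ i).

Lemma bform_powsum c (v : 'I_3 -> K * K) : bform (powsum c v) = \sum_j c j *: lin (v j)
    ^+ 5.
Proof.
rewrite /bform; under eq_bigr do rewrite /powsum mulr_sumr scaler_suml.
rewrite exchange_big; apply: eq_bigr => j _; rewrite exprDn scaler_sumr.
apply: eq_bigr => i _; rewrite !exprZn /mon mpolyXD !mpolyXn.
rewrite -!scalerAl -!scalerAr -scaler_nat !scalerA; congr (_ *: _); ring.
Qed.

Lemma gl_act_powsum g c (v : 'I_3 -> K * K) :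
  bcoef (gl_act g (bform (powsum c v))) =1
  powsum c (fun j => vmulmx (v j) (invmx g)).
Proof.
move=> i; rewrite -[RHS]bcoef_bform !bform_powsum gl_act_sum; congr (bcoef _ _).
by apply: eq_bigr => j _; rewrite gl_actZ gl_actX gl_act_lin.
Qed.

(** Restricting to determinant 1 removes the weight, and for the B_k this condition can be read off
    from the brackets of the roots. *)
Definition sl2_invariant p (J : {mpoly K[p.+1]}) : Prop :=
  forall g : 'M[K]_2, \det g = 1 -> forall a,
  J.@[bcoef (gl_act g (bform a))] = J.@[a].

(** The forms x_1, x_2 and -(x_1 + x_2). As they add up to zero, any permutation of them is a linear
    substitution of determinant 1 or -1. *)
Definition std3 (j : 'I_3) : K * K :=
  if j == 0 :> nat then (1, 0) else if j == 1 :> nat then (0, 1) else (- 1, - 1).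

Definition mx2 u v : 'M[K]_2 :=
  \matrix_(i, j) (if i == ord0 then (if j == ord0 then u.1 else u.2)
                  else if j == ord0 then v.1 else v.2).

Lemma det_mx2 u v : \det (mx2 u v) = bracket u v.
Proof.
rewrite (expand_det_row _ ord0) sum_I2 /cofactor !det_mx11 !mxE /= /bracket.
by rewrite expr0 expr1; ring.
Qed.

End BinaryForms.

Section Sylvester.
Variable K : numClosedFieldType.

(* When the determinant is -1, scaling the v_j by 'i makes it 1 and multiplies
   the quintic by 'i, which J does not see since 4 divides d. *)
Lemma powsum_std3 d (J : {mpoly K[6]}) (c : 'I_3 -> K) (v : 'I_3 -> K * K) :
  sl2_invariant J -> J \is d.-homog -> (4 %| d)%N ->
  (v 0).1 + (v 1).1 + (v 2%R).1 = 0 -> (v 0).2 + (v 1).2 + (v 2%R).2 = 0 ->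
  bracket (v 0) (v 1) ^+ 2 = 1 ->
  J.@[powsum c v] = J.@[powsum c (@std3 K)].
Proof.
move=> invJ hJ d4.
have det1 w : (w 0).1 + (w 1).1 + (w 2%R).1 = 0 ->
    (w 0).2 + (w 1).2 + (w 2%R).2 = 0 -> bracket (w 0) (w 1) = 1 ->
    J.@[powsum c w] = J.@[powsum c (@std3 K)].
  move=> s1 s2 dt; pose h := mx2 (w 0) (w 1).
  have deth : \det h = 1 by rewrite det_mx2.
  have uh : h \in unitmx by rewrite unitmxE deth unitr1.
  rewrite -[RHS](invJ (invmx h)) ?det_inv ?deth ?invr1 //.
  apply: meval_eq => i; rewrite [RHS]gl_act_powsum invmxK /powsum.
  congr (_ * _); apply: eq_bigr => j _; congr (_ * _).
  have -> : w j = vmulmx (std3 K j) h; last by [].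
  rewrite /vmulmx /std3 !mxE /=.
  case: j => -[|[|[|//]]] lt /=.
  - rewrite (_ : Ordinal lt = 0); last exact: val_inj.
    by rewrite [LHS]surjective_pairing; congr (_, _); ring.
  - rewrite (_ : Ordinal lt = 1); last exact: val_inj.
    by rewrite [LHS]surjective_pairing; congr (_, _); ring.
  - rewrite (_ : Ordinal lt = 2%R); last exact: val_inj.
    move/eqP: s1; rewrite addrC addr_eq0 => /eqP s1.
    move/eqP: s2; rewrite addrC addr_eq0 => /eqP s2.
    by rewrite [LHS]surjective_pairing s1 s2; congr (_, _); ring.
move=> s1 s2 /eqP; rewrite sqrf_eq1 => /orP[/eqP|/eqP] dt; first exact: det1.
have i2 : 'i * 'i = - 1 :> K by rewrite -expr2 sqrCi.
pose w j := ('i * (v j).1, 'i * (v j).2).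
rewrite -(det1 w) /=; first last.
- rewrite -[RHS]opprK -dt -mulN1r -i2 /bracket /=; ring.
- by rewrite -!mulrDr s2 mulr0.
- by rewrite -!mulrDr s1 mulr0.
have i4 : 'i ^+ 4 = 1 :> K by rewrite (exprM _ 2 2) sqrCi sqrrN expr1n.
have -> : J.@[powsum c w] = J.@[fun i => 'i * powsum c v i].
  apply: meval_eq => i; rewrite /powsum [RHS]mulrCA [in RHS]mulr_sumr; congr (_ * _).
  have i5 : (i <= 5)%N by rewrite -ltnS.
  apply: eq_bigr => j _; rewrite /= !exprMn.
  by rewrite [X in _ * X = _]mulrACA -exprD subnK ?i5 // exprS i4 mulr1 [LHS]mulrCA.
by rewrite (meval_dhomog 'i (powsum c v) hJ) -(divnK d4) mulnC exprM i4 expr1n mul1r.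
Qed.

End Sylvester.

(** * The invariants of degrees 4, 8 and 12 *)

Section Covariants.
Variable A : comNzRingType.
Implicit Type a : nat -> A.

(* The quadratic covariant (F, F)_4 of the quintic with coefficients
   ['C(5, i) * a i]. *)
Definition cov0 a := a 0%N * a 4%N - 4%:R * a 1%N * a 3%N + 3%:R * a 2%N ^+ 2.
Definition cov1 a := a 0%N * a 5%N - 3%:R * a 1%N * a 4%N + 2%:R * a 2%N * a 3%N.
Definition cov2 a := a 1%N * a 5%N - 4%:R * a 2%N * a 4%N + 3%:R * a 3%N ^+ 2.

(* Minor on the columns i, j, k of the 3 x 4 Hankel matrix of a. The signed
   minors can0 .. can3 are the coefficients of the cubic apolar to the quintic
   (its canonizant); I12 is the discriminant of that cubic, and I8 pairs its
   Hessian with the quadratic covariant. *)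
Definition det3 a (i j k : nat) : A :=
  a i * (a j.+1 * a k.+2 - a k.+1 * a j.+2)
  - a j * (a i.+1 * a k.+2 - a k.+1 * a i.+2)
  + a k * (a i.+1 * a j.+2 - a j.+1 * a i.+2).

Definition can0 a := det3 a 1 2 3.
Definition can1 a := - det3 a 0 2 3.
Definition can2 a := det3 a 0 1 3.
Definition can3 a := - det3 a 0 1 2.

Definition I4 a := cov1 a ^+ 2 - 4%:R * cov0 a * cov2 a.

Definition I8 a :=
  - (2%:R * (can2 a ^+ 2 - 3%:R * can3 a * can1 a) * cov2 a
     + (can2 a * can1 a - 9%:R * can3 a * can0 a) * cov1 a
     + 2%:R * (can1 a ^+ 2 - 3%:R * can2 a * can0 a) * cov0 a).

Definition I12 a :=
  can1 a ^+ 2 * can2 a ^+ 2 - 4%:R * can0 a * can2 a ^+ 3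
  - 4%:R * can1 a ^+ 3 * can3 a + 18%:R * can0 a * can1 a * can2 a * can3 a
  - 27%:R * can0 a ^+ 2 * can3 a ^+ 2.

(** This expands a 4 x 4 determinant with a repeated row, since row [i] already occurs in the Hankel
    matrix. It is read below as a linear recurrence of order 3 for the coefficients. *)
Lemma can_rec a (i : nat) : (i < 3)%N ->
  can0 a * a i + can1 a * a i.+1 + can2 a * a i.+2 + can3 a * a i.+3 = 0.
Proof. by case: i => [|[|[|//]]] _; rewrite /can0 /can1 /can2 /can3 /det3; ring. Qed.

Section PowerSums.
Variables (c0 c1 c2 p0 p1 p2 q0 q1 q2 : A).
Let s (i : nat) : A := c0 * (p0 ^+ (5 - i) * q0 ^+ i)
  + c1 * (p1 ^+ (5 - i) * q1 ^+ i) + c2 * (p2 ^+ (5 - i) * q2 ^+ i).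
Let d01 := p0 * q1 - q0 * p1.
Let d02 := p0 * q2 - q0 * p2.
Let d12 := p1 * q2 - q1 * p2.
Let X01 := c0 * c1 * d01 ^+ 4.
Let X02 := c0 * c2 * d02 ^+ 4.
Let X12 := c1 * c2 * d12 ^+ 4.
Let C := c0 * c1 * c2 * (d01 * d02 * d12) ^+ 2.

(** The fourth transvectant is bilinear, kills each pair of equal powers, and sends two fifth powers
    to the product of their linear forms times the fourth power of their determinant. *)
Lemma cov0_powsum : cov0 s = X01 * (p0 * p1) + X02 * (p0 * p2) + X12 * (p1 * p2).
Proof. by rewrite /cov0 /s /X01 /X02 /X12 /d01 /d02 /d12 !subSS !subn0; ring. Qed.

Lemma cov1_powsum : cov1 s = X01 * (p0 * q1 + q0 * p1)
  + X02 * (p0 * q2 + q0 * p2) + X12 * (p1 * q2 + q1 * p2).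
Proof. by rewrite /cov1 /s /X01 /X02 /X12 /d01 /d02 /d12 !subSS !subn0; ring. Qed.

Lemma cov2_powsum : cov2 s = X01 * (q0 * q1) + X02 * (q0 * q2) + X12 * (q1 * q2).
Proof. by rewrite /cov2 /s /X01 /X02 /X12 /d01 /d02 /d12 !subSS !subn0; ring. Qed.

(** The Hankel matrix of a sum of three powers factors through two Vandermonde matrices. By
    Cauchy-Binet its minors are, up to the factor [C], the coefficients of the cubic vanishing at
    the three points. *)
Lemma can0_powsum : can0 s = C * (q0 * q1 * q2).
Proof. by rewrite /can0 /det3 /s /C /d01 /d02 /d12 !subSS !subn0; ring. Qed.

Lemma can1_powsum : can1 s = - C * (p0 * q1 * q2 + q0 * p1 * q2 + q0 * q1 * p2).
Proof. by rewrite /can1 /det3 /s /C /d01 /d02 /d12 !subSS !subn0; ring. Qed.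

Lemma can2_powsum : can2 s = C * (p0 * p1 * q2 + p0 * q1 * p2 + q0 * p1 * p2).
Proof. by rewrite /can2 /det3 /s /C /d01 /d02 /d12 !subSS !subn0; ring. Qed.

Lemma can3_powsum : can3 s = - C * (p0 * p1 * p2).
Proof. by rewrite /can3 /det3 /s /C /d01 /d02 /d12 !subSS !subn0; ring. Qed.

End PowerSums.
End Covariants.

Lemma sum_I3 (V : nmodType) (F : 'I_3 -> V) :
  \sum_i F i = F 0 + F 1 + F 2%R.
Proof.
rewrite !big_ord_recl big_ord0 addr0 addrA.
by congr (F _ + F _ + F _); apply: val_inj.
Qed.

Section RMorphism.
Variables (A B : comNzRingType) (f : {rmorphism A -> B}) (a : nat -> A).

Let rmorph_det3 i j k : f (det3 a i j k) = det3 (f \o a) i j k.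
Proof. by rewrite /det3 /=; ring. Qed.

Lemma rmorph_can : [/\ f (can0 a) = can0 (f \o a), f (can1 a) = can1 (f \o a),
  f (can2 a) = can2 (f \o a) & f (can3 a) = can3 (f \o a)].
Proof. by split; rewrite /can0 /can1 /can2 /can3 ?rmorphN rmorph_det3. Qed.

Lemma rmorph_cov : [/\ f (cov0 a) = cov0 (f \o a), f (cov1 a) = cov1 (f \o a)
  & f (cov2 a) = cov2 (f \o a)].
Proof. by rewrite /cov0 /cov1 /cov2 /=; split; ring. Qed.

Lemma rmorph_I4 : f (I4 a) = I4 (f \o a).
Proof. by rewrite /I4; case: rmorph_cov => <- <- <-; ring. Qed.

Lemma rmorph_I8 : f (I8 a) = I8 (f \o a).
Proof.
by rewrite /I8; case: rmorph_cov => <- <- <-; case: rmorph_can => <- <- <- <-; ring.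
Qed.

Lemma rmorph_I12 : f (I12 a) = I12 (f \o a).
Proof. by rewrite /I12; case: rmorph_can => <- <- <- <-; ring. Qed.

End RMorphism.

Section Invariants.
Variable K : numFieldType.

Definition ncoef (v : 'I_6 -> K) (i : nat) : K := v (inord i) / 'C(5, i)%:R.

Definition npoly (i : nat) : {mpoly K[6]} := 'C(5, i)%:R^-1 *: 'X_(inord i).

Definition I4P := I4 npoly.
Definition I8P := I8 npoly.
Definition I12P := I12 npoly.

Lemma meval_npoly v i : (npoly i).@[v] = ncoef v i.
Proof. by rewrite /npoly mevalZ mevalXU mulrC. Qed.

Let meval_npolyE v : meval v \o npoly = ncoef v.
Proof. by apply/funext => i; exact: meval_npoly. Qed.

Lemma I4P_meval v : I4P.@[v] = I4 (ncoef v).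
Proof. by rewrite -meval_npolyE; apply: rmorph_I4. Qed.

Lemma I8P_meval v : I8P.@[v] = I8 (ncoef v).
Proof. by rewrite -meval_npolyE; apply: rmorph_I8. Qed.

Lemma I12P_meval v : I12P.@[v] = I12 (ncoef v).
Proof. by rewrite -meval_npolyE; apply: rmorph_I12. Qed.

Lemma ncoefZ c v i : ncoef (fun j => c * v j) i = c * ncoef v i.
Proof. by rewrite /ncoef mulrA. Qed.

Lemma I4P_homog : I4P \is 4.-homog.
Proof.
apply: dhomog_meval => v; rewrite !I4P_meval /I4 /cov0 /cov1 /cov2 !ncoefZ; ring.
Qed.

Lemma I8P_homog : I8P \is 8.-homog.
Proof.
apply: dhomog_meval => v.
by rewrite !I8P_meval /I8 /cov0 /cov1 /cov2 /can0 /can1 /can2 /can3 /det3 !ncoefZ; ring.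
Qed.

Lemma I12P_homog : I12P \is 12.-homog.
Proof.
apply: dhomog_meval => v; rewrite !I12P_meval.
(* Proving each [can_i] cubic separately lets the final [ring] handle four atoms instead of an
   expanded form of degree 12. *)
have E f : (forall w, f (ncoef (fun j => 2 * w j)) = 2 ^+ 3 * f (ncoef w) :> K) ->
  f (ncoef (fun j => 2 * v j)) = 2 ^+ 3 * f (ncoef v) by [].
rewrite /I12 (E (@can0 K)) ?(E (@can1 K)) ?(E (@can2 K)) ?(E (@can3 K)); last first.
- by move=> w; rewrite /can0 /det3 !ncoefZ; ring.
- by move=> w; rewrite /can1 /det3 !ncoefZ; ring.
- by move=> w; rewrite /can2 /det3 !ncoefZ; ring.
- by move=> w; rewrite /can3 /det3 !ncoefZ; ring.
move: (can0 _) (can1 _) (can2 _) (can3 _) => *; ring.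
Qed.

Section Sylvester.
Variables (c : 'I_3 -> K) (v : 'I_3 -> K * K).
Hypotheses (v1 : (v 0).1 + (v 1).1 + (v 2%R).1 = 0)
  (v2 : (v 0).2 + (v 1).2 + (v 2%R).2 = 0) (dv : bracket (v 0) (v 1) ^+ 2 = 1).

Let s1 := c 0 + c 1 + c 2%R.
Let s2 := c 0 * c 1 + c 0 * c 2%R + c 1 * c 2%R.
Let s3 := c 0 * c 1 * c 2%R.

Let pE : (v 2%R).1 = - (v 0).1 - (v 1).1.
Proof. by apply/eqP; rewrite -opprD -addr_eq0 addrC v1. Qed.

Let qE : (v 2%R).2 = - (v 0).2 - (v 1).2.
Proof. by apply/eqP; rewrite -opprD -addr_eq0 addrC v2. Qed.

Let d01 := (v 0).1 * (v 1).2 - (v 0).2 * (v 1).1.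
Let dE2 : d01 ^+ 2 = 1. Proof. exact: dv. Qed.
Let dE4 : d01 ^+ 4 = 1. Proof. by rewrite (exprM _ 2 2) dE2 expr1n. Qed.
Let dE6 : d01 ^+ 6 = 1. Proof. by rewrite (exprM _ 2 3) dE2 expr1n. Qed.
Let d02E : (v 0).1 * (v 2%R).2 - (v 0).2 * (v 2%R).1 = - d01.
Proof. by rewrite pE qE /d01; ring. Qed.
Let d12E : (v 1).1 * (v 2%R).2 - (v 1).2 * (v 2%R).1 = d01.
Proof. by rewrite pE qE /d01; ring. Qed.

Let s (i : nat) : K := c 0 * ((v 0).1 ^+ (5 - i) * (v 0).2 ^+ i)
  + c 1 * ((v 1).1 ^+ (5 - i) * (v 1).2 ^+ i)
  + c 2%R * ((v 2%R).1 ^+ (5 - i) * (v 2%R).2 ^+ i).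

Let ncoef_powsum i : (i < 6)%N -> ncoef (powsum c v) i = s i.
Proof.
move=> i6; rewrite /ncoef /powsum inordK // mulrC mulKf; first by rewrite sum_I3.
by rewrite pnatr_eq0 -lt0n bin_gt0.
Qed.

Let covE : [/\ cov0 (ncoef (powsum c v)) = cov0 s,
  cov1 (ncoef (powsum c v)) = cov1 s & cov2 (ncoef (powsum c v)) = cov2 s].
Proof. by split; rewrite /cov0 /cov1 /cov2 !ncoef_powsum. Qed.

Let canE : [/\ can0 (ncoef (powsum c v)) = can0 s,
  can1 (ncoef (powsum c v)) = can1 s, can2 (ncoef (powsum c v)) = can2 s &
  can3 (ncoef (powsum c v)) = can3 s].
Proof. by split; rewrite /can0 /can1 /can2 /can3 /det3 !ncoef_powsum. Qed.

Let d01E : (v 0).1 * (v 1).2 - (v 0).2 * (v 1).1 = d01. Proof. by []. Qed.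

Let dC : (d01 * - d01 * d01) ^+ 2 = 1.
Proof. by rewrite -dE6; ring. Qed.
Let dN4 : (- d01) ^+ 4 = 1.
Proof. by rewrite -dE4; ring. Qed.


Lemma I4P_sylvester : I4P.@[powsum c v] = s2 ^+ 2 - 4%:R * s1 * s3.
Proof.
rewrite I4P_meval /I4; case: covE => -> -> ->.
rewrite cov0_powsum cov1_powsum cov2_powsum d01E d02E d12E dN4 dE4 !mulr1 pE qE.
(* Multiplying the right-hand side by the power of [d01] that matches the left one, here the square,
   makes this an unconditional polynomial identity. *)
by rewrite -[RHS]mulr1 -[X in _ = _ * X]dE2 /s1 /s2 /s3 /d01; ring.
Qed.

Lemma I8P_sylvester : I8P.@[powsum c v] = s3 ^+ 2 * s2.
Proof.
rewrite I8P_meval /I8; case: covE => -> -> ->; case: canE => -> -> -> ->.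
rewrite cov0_powsum cov1_powsum cov2_powsum.
rewrite can0_powsum can1_powsum can2_powsum can3_powsum.
rewrite d01E d02E d12E dN4 dE4 dC !mulr1 pE qE.
by rewrite -[RHS]mulr1 -[X in _ = _ * X]dE4 /s2 /s3 /d01; ring.
Qed.

Lemma I12P_sylvester : I12P.@[powsum c v] = s3 ^+ 4.
Proof.
rewrite I12P_meval /I12; case: canE => -> -> -> ->.
rewrite can0_powsum can1_powsum can2_powsum can3_powsum.
rewrite d01E d02E d12E dC !mulr1 pE qE.
by rewrite -[RHS]mulr1 -[X in _ = _ * X]dE6 /s3 /d01; ring.
Qed.

End Sylvester.
End Invariants.

(** * Sylvester's normal form *)

Section CanonicalForm.
Variable K : numClosedFieldType.

Lemma cubic_roots (k0 k1 k2 k3 : K) : k3 != 0 ->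
  exists r0 r1 r2, [/\ k0 = - k3 * (r0 * r1 * r2),
    k1 = k3 * (r0 * r1 + r0 * r2 + r1 * r2) & k2 = - k3 * (r0 + r1 + r2)].
Proof.
move=> nz3; pose p : {poly K} := Poly [:: k0; k1; k2; k3].
have sp : size p = 4 by rewrite /p (@PolyK _ 0).
have [r pE] := closed_field_poly_normal p.
have lp : lead_coef p = k3 by rewrite lead_coefE sp coef_Poly.
have sr : size r = 3.
  have := sp; rewrite pE lp size_scale // size_prod_XsubC.
  by case=> ->.
move: r sr pE => [|r0 [|r1 [|r2 [|//]]]] // _.
rewrite lp !big_cons big_nil mulr1 => pE.
have {}pE : p = Poly [:: - k3 * (r0 * r1 * r2);
    k3 * (r0 * r1 + r0 * r2 + r1 * r2); - k3 * (r0 + r1 + r2); k3].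
  rewrite pE /= !cons_poly_def -mul_polyC; ring.
exists r0, r1, r2.
have E i : p`_i = p`_i by [].
move: (E 0%N) (E 1%N) (E 2%N); rewrite {2 4 6}pE {E pE}.
by rewrite /p !coef_Poly.
Qed.

(** The canonizant gives a recurrence whose characteristic roots are distinct because [I12] does not
    vanish. Hence the coefficients are combinations of three geometric sequences, that is, of three
    fifth powers. The condition on [can3] keeps the roots finite. *)
Lemma sylvester_form (a : 'I_6 -> K) :
  can3 (ncoef a) != 0 -> I12 (ncoef a) != 0 ->
  exists c (v : 'I_3 -> K * K), [/\ (v 0).1 + (v 1).1 + (v 2%R).1 = 0,
    (v 0).2 + (v 1).2 + (v 2%R).2 = 0, bracket (v 0) (v 1) ^+ 2 = 1 &
    a =1 powsum c v].
Proof.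
move=> nz3 nzD; set b := ncoef a in nz3 nzD.
have [r0 [r1 [r2 [E0 E1 E2]]]] := cubic_roots (can0 b) (can1 b) (can2 b) nz3.
have DE : I12 b = can3 b ^+ 4 * ((r0 - r1) * (r0 - r2) * (r1 - r2)) ^+ 2.
  by rewrite /I12 E0 E1 E2; ring.
move: nzD; rewrite DE mulf_eq0 negb_or !expf_eq0 /= => /andP[_].
rewrite !mulf_eq0 !negb_or -andbA => /and3P[n01 n02 n12].
have rec i : (i < 3)%N -> b i.+3 =
    (r0 + r1 + r2) * b i.+2 - (r0 * r1 + r0 * r2 + r1 * r2) * b i.+1 + r0 * r1 * r2 * b i.
  move=> i3; have := can_rec b i3; rewrite E0 E1 E2 => H.
  apply: (mulfI nz3); apply/eqP; rewrite -subr_eq0; apply/eqP.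
  by rewrite -H; ring.
(* The weights solve the 3 x 3 Vandermonde system given by the first three coefficients, through
   Lagrange interpolation; the recurrence then propagates the formula to index 5. *)
pose m0 := (b 2%N - (r1 + r2) * b 1%N + r1 * r2 * b 0%N) / ((r0 - r1) * (r0 - r2)).
pose m1 := (b 2%N - (r0 + r2) * b 1%N + r0 * r2 * b 0%N) / ((r1 - r0) * (r1 - r2)).
pose m2 := (b 2%N - (r0 + r1) * b 1%N + r0 * r1 * b 0%N) / ((r2 - r0) * (r2 - r1)).
have n10 : r1 - r0 != 0 by rewrite -opprB oppr_eq0.
have n20 : r2 - r0 != 0 by rewrite -opprB oppr_eq0.
have n21 : r2 - r1 != 0 by rewrite -opprB oppr_eq0.
have bE i : (i < 6)%N -> b i = m0 * r0 ^+ i + m1 * r1 ^+ i + m2 * r2 ^+ i.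
  have b0 : b 0%N = m0 * r0 ^+ 0 + m1 * r1 ^+ 0 + m2 * r2 ^+ 0.
    by rewrite /m0 /m1 /m2; field; rewrite n01 n02 n12 n10 n20 n21.
  have b1 : b 1%N = m0 * r0 ^+ 1 + m1 * r1 ^+ 1 + m2 * r2 ^+ 1.
    by rewrite /m0 /m1 /m2; field; rewrite n01 n02 n12 n10 n20 n21.
  have b2 : b 2%N = m0 * r0 ^+ 2 + m1 * r1 ^+ 2 + m2 * r2 ^+ 2.
    by rewrite /m0 /m1 /m2; field; rewrite n01 n02 n12 n10 n20 n21.
  clearbody m0 m1 m2.
  have b3 : b 3%N = m0 * r0 ^+ 3 + m1 * r1 ^+ 3 + m2 * r2 ^+ 3.
    by rewrite rec // b2 b1 b0; ring.
  have b4 : b 4%N = m0 * r0 ^+ 4 + m1 * r1 ^+ 4 + m2 * r2 ^+ 4.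
    by rewrite rec // b3 b2 b1; ring.
  by case: i => [|[|[|[|[|[|//]]]]]] _ //; rewrite rec // b4 b3 b2; ring.
(* The multiples of (1, r_j) with sum zero are proportional to the differences of the other two
   roots. The factor [t] normalises the determinant of the first two vectors to -1, hence its square
   to 1. *)
pose t := (sqrtC ((r1 - r2) * (r2 - r0) * (r0 - r1)))^-1.
have tE : t ^+ 2 * ((r1 - r2) * (r2 - r0) * (r0 - r1)) = 1.
  by rewrite exprVn sqrtCK mulVf // !mulf_neq0.
have nzt : t != 0.
  by apply: contra_eq_neq tE => ->; rewrite expr0n mul0r eq_sym oner_eq0.
pose p0 := t * (r1 - r2); pose p1 := t * (r2 - r0); pose p2 := t * (r0 - r1).
exists (fun j : 'I_3 => nth 0 [:: m0 / p0 ^+ 5; m1 / p1 ^+ 5; m2 / p2 ^+ 5] j).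
exists (fun j : 'I_3 => nth (0, 0) [:: (p0, p0 * r0); (p1, p1 * r1); (p2, p2 * r2)] j).
split=> /=.
- by rewrite /p0 /p1 /p2; ring.
- by rewrite /p0 /p1 /p2; ring.
- rewrite /bracket /= (_ : _ - _ = - (t ^+ 2 * ((r1 - r2) * (r2 - r0) * (r0 - r1)))).
    by rewrite tE sqrrN expr1n.
  by rewrite /p0 /p1; ring.
- move=> i; rewrite /powsum sum_I3 /=.
  have cE (m p r : K) : p != 0 -> m / p ^+ 5 * (p ^+ (5 - i) * (p * r) ^+ i) = m * r ^+ i.
    move=> nzp; rewrite exprMn mulrA -!mulrA [p ^+ (5 - i) * _]mulrA -exprD.
    by rewrite subnK ?leq_ord // mulKf // expf_neq0.
  rewrite !cE ?mulf_neq0 // -bE // /b /ncoef inord_val mulrC divfK //.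
  by rewrite pnatr_eq0 -lt0n bin_gt0 leq_ord.
Qed.

End CanonicalForm.

Section Generation.
Variable K : numClosedFieldType.

Lemma meval_msym n (s : 'S_n) (p : {mpoly K[n]}) (c : 'I_n -> K) :
  (msym s p).@[c] = p.@[c \o s].
Proof.
rewrite /msym /mmap raddf_sum mevalE; apply: eq_bigr => m _.
rewrite /= mevalM mevalC rmorph_prod; congr (_ * _).
by apply: eq_bigr => i _; rewrite rmorphXn /= mevalXU.
Qed.

Lemma mesym3_meval (c : 'I_3 -> K) :
  [/\ (mesym 3 K 1).@[c] = c 0 + c 1 + c 2%R,
      (mesym 3 K 2).@[c] = c 0 * c 1 + c 0 * c 2%R + c 1 * c 2%R &
      (mesym 3 K 3).@[c] = c 0 * c 1 * c 2%R].
Proof.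
pose p : {poly K} := \prod_(x <- [tuple c j | j < 3]) ('X - x%:P).
have pE : p = Poly [:: - (c 0 * c 1 * c 2%R);
    c 0 * c 1 + c 0 * c 2%R + c 1 * c 2%R; - (c 0 + c 1 + c 2%R); 1].
  rewrite /p big_tuple !big_ord_recl big_ord0 !tnth_mktuple.
  have -> : lift ord0 (lift ord0 ord0) = 2%R :> 'I_3 by apply: val_inj.
  have -> : lift ord0 ord0 = 1 :> 'I_3 by apply: val_inj.
  by rewrite /= !cons_poly_def; ring.
have E (k : 'I_4) : (mesym 3 K k).@[c] = (-1) ^+ k * p`_(3 - k).
  rewrite mroots_coeff mulrA -exprD addnn -mul2n exprM sqrrN !expr1n mul1r.
  by apply: meval_eq => i; rewrite tnth_mktuple.
split.
- by rewrite (E (@Ordinal 4 1 isT)) pE coef_Poly /=; ring.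
- by rewrite (E (@Ordinal 4 2 isT)) pE coef_Poly /=; ring.
- by rewrite (E (@Ordinal 4 3 isT)) pE coef_Poly /=; ring.
Qed.

Definition I_tuple : 3.-tuple {mpoly K[6]} := [tuple I4P K; I8P K; I12P K].

Definition I_point (a : 'I_6 -> K) : 'I_3 -> K :=
  fun j => nth 0 [:: I4 (ncoef a); I8 (ncoef a); I12 (ncoef a)] j.

Lemma meval_I_tuple (P : {mpoly K[3]}) a :
  (P \mPo I_tuple).@[a] = P.@[I_point a].
Proof.
rewrite comp_mpoly_meval; apply: meval_eq => j; rewrite (tnth_nth 0) /I_point /=.
by case: j => -[|[|[|//]]] lt /=; rewrite ?I4P_meval ?I8P_meval ?I12P_meval.
Qed.

Definition binform (b : nat -> K) (i : 'I_6) : K := 'C(5, i)%:R * b i.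

Lemma ncoef_binform b i : (i < 6)%N -> ncoef (binform b) i = b i.
Proof.
move=> i6; rewrite /ncoef /binform inordK // mulrC mulKf //.
by rewrite pnatr_eq0 -lt0n bin_gt0.
Qed.

Section Restriction.
Variables (d : nat) (J : {mpoly K[6]}).
Hypotheses (invJ : sl2_invariant J) (hJ : J \is d.-homog) (d4 : (4 %| d)%N).

(** The coefficients of the normal form are linear in [c], so the restriction has degree [d] in [c].
    The elementary symmetric functions have degrees 1, 2, 3, which explains the weights. *)
Lemma symmetric_restriction : exists2 t : {mpoly K[3]},
  (forall m, m \in msupp t -> (m 0%R + 2 * m 1%R + 3 * m 2%R = d)%N) &
  forall c, J.@[powsum c (@std3 K)] = t.@[fun j =>
    nth 0 [:: c 0 + c 1 + c 2%R; c 0 * c 1 + c 0 * c 2%R + c 1 * c 2%R;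
              c 0 * c 1 * c 2%R] j].
Proof.
pose X (i : 'I_6) : {mpoly K[3]} :=
  \sum_j ('C(5, i)%:R * ((std3 K j).1 ^+ (5 - i) * (std3 K j).2 ^+ i)) *: 'X_j.
pose s := J \mPo [tuple X i | i < 6].
have sE c : s.@[c] = J.@[powsum c (@std3 K)].
  rewrite comp_mpoly_meval; apply: meval_eq => i; rewrite tnth_mktuple.
  rewrite raddf_sum /powsum mulr_sumr; apply: eq_bigr => j _.
  by rewrite /= mevalZ mevalXU mulrAC -mulrA.
have sym_s : s \is symmetric.
  apply/issymP => u.
  have perm_sum (f : 'I_3 -> K) : f (u 0) + f (u 1) + f (u 2%R) = f 0 + f 1 + f 2%R.
    by rewrite -(sum_I3 (f \o u)) -sum_I3 [RHS](reindex_inj (@perm_inj _ u)).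
  apply: mpoly_eq_meval => c; rewrite meval_msym !sE.
  (* Permuting the coefficients together with the forms leaves the quintic unchanged, and the
     permuted forms can be brought back to [std3]. *)
  rewrite -(@powsum_std3 K d J (c \o u) (@std3 K \o u)) //=.
  - apply: meval_eq => i; rewrite /powsum; congr (_ * _).
    by rewrite [RHS](reindex_inj (@perm_inj _ u)).
  - by rewrite (perm_sum (fun j => (std3 K j).1)) /std3 /=; ring.
  - by rewrite (perm_sum (fun j => (std3 K j).2)) /std3 /=; ring.
  - have : u 0 != u 1 by rewrite (inj_eq perm_inj).
    case: (u 0) (u 1) => [[|[|[|//]]] ?] [[|[|[|//]]] ?] // _;
      rewrite /bracket /std3 /=; ring.
have hX i : X i \is 1.-homog.
  by apply: rpred_sum => j _; apply: rpredZ; rewrite dhomogX /= mdeg1.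
have hs : s \is d.-homog.
  apply: dhomog_meval => c; rewrite !comp_mpoly_meval -(meval_dhomog _ _ hJ).
  by apply: meval_eq => i; rewrite tnth_mktuple (meval_dhomog _ _ (hX i)).
have [t [tE ht]] := sym_fundamental_homog sym_s hs.
exists t => [m mt|c].
  rewrite -(dhomog_mf ht mt) /= /mnmwgt sum_I3 /= muln1.
  by rewrite (mulnC (m 1%R)) (mulnC (m 2%R)).
rewrite -sE -tE comp_mpoly_meval; apply: meval_eq => j.
rewrite tnth_mktuple; have [e1 e2 e3] := mesym3_meval c.
by case: j => -[|[|[|//]]] lt /=.
Qed.

End Restriction.
End Generation.

(** * Generation of the invariants of degree divisible by 4 *)

Section Generators.
Variable K : numClosedFieldType.

Lemma I12P_neq0 : I12P K != 0.
Proof.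
pose b (i : nat) : K := (i == 0%N)%:R + (i == 3)%:R.
apply/eqP => /(congr1 (meval (binform b))); rewrite meval0 I12P_meval.
rewrite /I12 /can0 /can1 /can2 /can3 /det3 !ncoef_binform // /b /=.
move/eqP; rewrite (_ : _ - _ = - 27%:R); last by ring.
by rewrite oppr_eq0 pnatr_eq0.
Qed.

Lemma can3_neq0 : can3 (@npoly K) != 0.
Proof.
pose b (i : nat) : K := (i == 0%N)%:R + (i == 3)%:R.
have [_ _ _ E] := rmorph_can (meval (binform b)) (@npoly K).
apply/eqP => /(congr1 (meval (binform b))); rewrite meval0 E.
rewrite /can3 /det3 /= !meval_npoly !ncoef_binform // /b /=.
by move/eqP; rewrite (_ : - _ = 1) ?oner_eq0 //; ring.
Qed.

(* The forms [a x^5 + 5 m x^4 y + y^5] have [I12 = 0]. *)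
Lemma I12_eq0_slice (x y : K) :
  exists a, I_point a =1 (fun j => nth 0 [:: x; y; 0] j).
Proof.
(* On this slice [I4] is r^2 and [I8] is -2 m^5, so a square root and a fifth root reach every pair
   of values. *)
pose r := sqrtC x; pose m := 5.-root (- y / 2%:R).
exists (binform (fun i => nth 0 [:: r; m; 0; 0; 0; 1] i)).
have rE : r ^+ 2 = x by rewrite sqrtCK.
have mE : m ^+ 5 = - y / 2%:R by rewrite rootCK.
have nz2 : 2%:R != 0 :> K by rewrite pnatr_eq0.
case=> -[|[|[|//]]] lt; rewrite /I_point /=.
- by rewrite /I4 /cov0 /cov1 /cov2 !ncoef_binform //= -rE; ring.
- rewrite /I8 /cov0 /cov1 /cov2 /can0 /can1 /can2 /can3 /det3 !ncoef_binform //=.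
  transitivity (- (2%:R * m ^+ 5)); first by ring.
  by rewrite mE; field.
- by rewrite /I12 /can0 /can1 /can2 /can3 /det3 !ncoef_binform //=; ring.
Qed.

Lemma I12P_cancel (J : {mpoly K[6]}) (P : {mpoly K[3]}) :
  I12P K * J = P \mPo I_tuple K -> exists P', J = P' \mPo I_tuple K.
Proof.
(* [P0] collects the terms free of the third variable. Where [I12] vanishes the hypothesis reduces
   to the vanishing of [P0] at arbitrary values of [I4] and [I8]. *)
move=> E; pose P0 := \sum_(m <- msupp P | m 2%R == 0%N) P@_m *: 'X_[m].
pose P1 := \sum_(m <- msupp P | m 2%R != 0%N) P@_m *: 'X_[K, (m - U_(2%R))].
have PE : P = P0 + 'X_(2%R) * P1.
  rewrite {1}[P]mpolyE (bigID (fun m : 'X_{1..3} => m 2%R == 0%N)) /=; congr (_ + _).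
  rewrite mulr_sumr; apply: eq_bigr => m nz; rewrite -scalerAr -mpolyXD; congr (_ *:
      'X_[_]).
  by rewrite addmC submK // lep1mP.
have P00 : P0 = 0.
  apply: mpoly_eq0_meval => v.
  have E0 : P0.@[v] = P0.@[fun j => nth 0 [:: v 0; v 1; 0] j].
    rewrite !raddf_sum; apply: eq_bigr => m /eqP m2 /=; rewrite !mevalZ !mevalX.
    congr (_ * _); apply: eq_bigr => -[[|[|[|//]]] lt] _ /=.
    - by congr (v _ ^+ _); apply: val_inj.
    - by congr (v _ ^+ _); apply: val_inj.
    - by rewrite (_ : Ordinal lt = 2%R) ?m2 //; apply: val_inj.
  rewrite E0; have [a aE] := I12_eq0_slice (v 0) (v 1).
  have := congr1 (meval a) E; rewrite mevalM I12P_meval meval_I_tuple.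
  have := aE 2%R; rewrite {1}/I_point /= => ->; rewrite mul0r => /esym.
  rewrite (meval_eq _ aE) PE mevalD mevalM mevalXU /= mul0r addr0 => H.
  exact: H.
exists P1; apply: (mulfI I12P_neq0); rewrite E PE P00 add0r rmorphM /=.
by rewrite comp_mpolyXU.
Qed.

Lemma I12P_cancel_exp n (J : {mpoly K[6]}) (P : {mpoly K[3]}) :
  I12P K ^+ n * J = P \mPo I_tuple K -> exists P', J = P' \mPo I_tuple K.
Proof.
elim: n P => [|n IHn] P; first by rewrite mul1r; exists P.
by rewrite exprS -mulrA => /I12P_cancel [P' /IHn].
Qed.

Theorem sl2_invariant_generators d (J : {mpoly K[6]}) :
  sl2_invariant J -> J \is d.-homog -> (4 %| d)%N ->
  exists2 P : {mpoly K[3]}, J = P \mPo I_tuple K &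
    forall m, m \in msupp P -> (4 * m 0%R + 8 * m 1%R + 12 * m 2%R = d)%N.
Proof.
move=> invJ hJ d4; have [t wt tE] := symmetric_restriction invJ hJ d4.
(* Replacing s1 and s2 costs 5 and 2 factors s3 respectively, and [I12 ^+ (2 * d)] supplies 8d of
   them; what remains must be a power of s3^4. The division is exact because m 0 + 2 m 1 + 3 m 2 = d
   is divisible by 4, and 5 m 0 + 2 m 1 <= 5d rules out truncation. *)
pose e (m : 'X_{1..3}) := ((8 * d + m 2%R - 5 * m 0%R - 2 * m 1%R) %/ 4)%N.
pose P : {mpoly K[3]} := \sum_(m <- msupp t) t@_m *:
  ((4%:R^-1 *: ('X_1 ^+ 2 - 'X_0 * 'X_(2%R))) ^+ m 0%R * 'X_1 ^+ m 1%R * 'X_(2%R) ^+ e m).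
have nz4 : 4%:R != 0 :> K by rewrite pnatr_eq0.
have [P' JE] : exists P', J = P' \mPo I_tuple K.
  (* On normal forms, (I8^2 - I4 I12) / 4 = s1 s3^5 and I8 = s2 s3^2. *)
  apply: (@I12P_cancel_exp (2 * d) J P).
  have nzD : can3 (@npoly K) * I12P K != 0 by rewrite mulf_neq0 ?can3_neq0 ?I12P_neq0.
  apply: (mpoly_eq_dense nzD) => a.
  have [_ _ _ cE] := rmorph_can (meval a) (@npoly K).
  rewrite mevalM cE I12P_meval mulf_eq0 negb_or => /andP[nz3 nz12].
  have {}nz3 : can3 (ncoef a) != 0.
    by rewrite /can3 /det3 /= !meval_npoly in nz3 *.
  have [c [v [v1 v2 dv aE]]] := sylvester_form nz3 nz12.
  rewrite !(meval_eq _ aE) mevalM rmorphXn /= (I12P_sylvester c v1 v2 dv).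
  rewrite (powsum_std3 c invJ hJ d4 v1 v2 dv) tE comp_mpoly_meval.
  set s1 := c 0 + _ + _; set s2 := _ + c 1 * _; set s3 := _ * c 2%R.
  rewrite [RHS](@meval_eq _ _ _ (fun j => nth 0 [:: s2 ^+ 2 - 4%:R * s1 * s3; s3 ^+ 2 *
      s2; s3 ^+ 4] j)); last first.
    move=> j; rewrite (tnth_nth 0).
    by case: j => -[|[|[|//]]] lt /=; rewrite ?(I4P_sylvester c v1 v2 dv)
      ?(I8P_sylvester c v1 v2 dv) ?(I12P_sylvester c v1 v2 dv).
  rewrite mevalE mulr_sumr raddf_sum; apply: eq_big_seq => m mt.
  rewrite /= mevalZ mulrCA; congr (_ * _).
  rewrite !(mevalM, rmorphXn) /= mevalZ mevalB !(mevalM, mevalXU) /=.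
  have -> : 4%:R^-1 * ((s3 ^+ 2 * s2) ^+ 2 - (s2 ^+ 2 - 4%:R * s1 * s3) * s3 ^+ 4) = s1
      * s3 ^+ 5.
    by field.
  rewrite !big_ord_recl big_ord0 /= mulr1.
  rewrite (_ : lift ord0 (lift ord0 ord0) = 2%R); last exact: val_inj.
  rewrite (_ : lift ord0 ord0 = 1); last exact: val_inj.
  rewrite (_ : ord0 = 0); last exact: val_inj.
  have := wt m mt; rewrite /e; move: (m 0) (m 1) (m 2%R) => i j k w.
  set n := (_ %/ 4)%N; have nE : (4 * (2 * d) + k = 5 * i + 2 * j + 4 * n)%N.
    by rewrite /n; move: d4 w; clear; lia.
  transitivity (s1 ^+ i * s2 ^+ j * s3 ^+ (4 * (2 * d) + k)).
    by rewrite -(exprM s3) exprD; move: (s3 ^+ _) => S; ring.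
  clearbody s1 s2 s3; rewrite nE 2!exprD !exprM !exprMn; ring.
have hT i : tnth (I_tuple K) i \is (nth 0%N [:: 4; 8; 12] i).-homog.
  rewrite (tnth_nth 0); case: i => -[|[|[|//]]] lt /=.
  - exact: I4P_homog.
  - exact: I8P_homog.
  - exact: I12P_homog.
have [P'' PE wP] := comp_mpoly_dhomog hT hJ JE.
by exists P'' => // m /wP; rewrite sum_I3.
Qed.

End Generators.

(** * Roots of quintics and the invariants B_k *)

Section LinearProducts.
Variables (A : comNzRingType) (R : comAlgType A) (x y : R).

(** One multiplication by l.2 x - l.1 y. Prepending 0 shifts the index, and the default 0 supplies
    the missing last coefficient; on explicit roots the list simply computes. *)
Definition lstep (l : A * A) (c : seq A) : seq A :=
  [seq l.2 * nth 0 c i - l.1 * nth 0 (0 :: c) i | i <- iota 0 (size c).+1].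

(* Coefficients of [x ^ (n - i) * y ^ i] in the product of the [l.2 x - l.1 y]. *)
Definition lprod (s : seq (A * A)) : seq A := foldr lstep [:: 1] s.

Lemma size_lprod s : size (lprod s) = (size s).+1.
Proof. by elim: s => //= l s IHs; rewrite /lstep size_map size_iota IHs. Qed.

(** The general algebra allows two uses: binary forms in two variables, and polynomials in one
    variable with [y] equal to 1. *)
Lemma lprodE (s : seq (A * A)) :
  \prod_(l <- s) (l.2 *: x - l.1 *: y) =
  \sum_(i < (size s).+1) nth 0 (lprod s) i *: (x ^+ (size s - i) * y ^+ i).
Proof.
elim: s => [|l s IHs].
  by rewrite big_nil big_ord1 /= scale1r !expr0 mulr1.
rewrite big_cons IHs /=; set c := lprod s; set n := size s.
have sc : size c = n.+1 by rewrite size_lprod.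
have stepE i : (i < n.+2)%N ->
    nth 0 (lstep l c) i = l.2 * nth 0 c i - l.1 * nth 0 (0 :: c) i.
  by move=> i2; rewrite /lstep (nth_map 0%N) ?size_iota ?sc // nth_iota.
transitivity (\sum_(i < n.+2) ((l.2 * nth 0 c i) *: (x ^+ (n.+1 - i) * y ^+ i)
    - (l.1 * nth 0 (0 :: c) i) *: (x ^+ (n.+1 - i) * y ^+ i))); last first.
  by apply: eq_bigr => i _; rewrite stepE // scalerBl.
rewrite big_split sumrN /=.
rewrite [X in _ = X - _]big_ord_recr /= [nth 0 c n.+1]nth_default ?sc // mulr0 scale0r
    addr0.
rewrite [X in _ = _ - X]big_ord_recl /= mulr0 scale0r add0r mulrBl.
congr (_ - _); rewrite -scalerAl mulr_sumr scaler_sumr; apply: eq_bigr => i _.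
  by rewrite subSn ?leq_ord // exprS -scalerAr scalerA mulrA.
by rewrite /bump /= subSS exprS -scalerAr scalerA mulrCA.
Qed.

End LinearProducts.

Section RootFormulas.
Variable A : comNzRingType.
Implicit Types l : A * A.

Lemma linformE l : linform l = l.2 *: 'X_ord0 - l.1 *: 'X_ord_max.
Proof. by rewrite /linform /bracket /= ![_ * _%:MP]mulrC !mul_mpolyC. Qed.

Lemma bcoef_prod (n : nat) (s : seq (A * A)) (i : 'I_n.+1) : size s = n ->
  bcoef (\prod_(l <- s) linform l) i = nth 0 (lprod s) i.
Proof.
move=> sn; under eq_bigr do rewrite linformE.
have monE j : 'X_ord0 ^+ (n - j) * 'X_ord_max ^+ j = 'X_[A, mon n j].
  by rewrite /mon mpolyXD !mpolyXn.
rewrite lprodE sn /bcoef raddf_sum (bigD1 i) //= big1 ?addr0.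
  by rewrite monE mcoeffZ mcoeffX eqxx mulr1.
move=> j ne; rewrite monE mcoeffZ mcoeffX; case: eqP => [e|]; last by rewrite mulr0.
case/eqP: ne; apply: val_inj.
by have := congr1 (fun m : 'X_{1..2} => m ord_max) e; rewrite /= !mon1.
Qed.

(* The pair (4 S0^3, 4 S0^3 - T0^2) of the quartic with roots a, b, c, e, in
   terms of u = (ab)(ce) and v = (ac)(eb): S0 = u^2 + uv + v^2 and
   T0 = (v - u)(2u + v)(u + 2v). *)
Definition zroot (a b c e : A * A) : A * A :=
  let u := bracket a b * bracket c e in
  let v := bracket a c * bracket e b in
  (4%:R * (u ^+ 2 + u * v + v ^+ 2) ^+ 3, 27%:R * (u * v * (u + v)) ^+ 2).

(** The coefficient of z is a multiple of the discriminant: 4 S0^3 - T0^2 = 27 (u v (u + v))^2,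
    where by the Plücker relation u + v is, up to sign, the third product (ae)(bc). *)
Lemma zfacE (a b c e : A * A) :
  zfac (\prod_(l <- [:: a; b; c; e]) linform l) =
  (zroot a b c e).2 *: 'X - (zroot a b c e).1%:P.
Proof.
set Q := \prod_(l <- _) _.
have cE k : (k < 5)%N -> bcoef (p := 4) Q (inord k) = nth 0 (lprod [:: a; b; c; e]) k.
  by move=> k5; rewrite bcoef_prod // inordK.
have SE : S0 Q = (bracket a b * bracket c e) ^+ 2
    + bracket a b * bracket c e * (bracket a c * bracket e b)
    + (bracket a c * bracket e b) ^+ 2.
  by rewrite /S0 !cE //= /bracket; ring.
have TE : T0 Q ^+ 2 = 4%:R * S0 Q ^+ 3 - (zroot a b c e).2.
  rewrite SE (_ : T0 Q = (bracket a c * bracket e b - bracket a b * bracket c e)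
    * (2%:R * (bracket a b * bracket c e) + bracket a c * bracket e b)
    * (bracket a b * bracket c e + 2%:R * (bracket a c * bracket e b))).
    by rewrite /zroot /=; ring.
  by rewrite /T0 !cE //= /bracket; ring.
have E3 : 4%:R * S0 Q * S0 Q * S0 Q = 4%:R * S0 Q ^+ 3 by ring.
rewrite /zfac E3 -expr2 TE opprB addrCA subrr addr0 SE.
by rewrite /zroot.
Qed.

Lemma zintE (a b c e f : A * A) :
  zint (fun j : 'I_5 => nth (0, 0) [:: a; b; c; e; f] j) =
  \prod_(r <- [:: zroot b c e f; zroot a c e f; zroot a b e f; zroot a b c f;
                  zroot a b c e]) (r.2 *: 'X - r.1%:P).
Proof.
rewrite /zint !big_cons big_nil -!zfacE !big_ord_recl big_ord0.
rewrite /quartic 5!(big_mkcond (fun j => j != _)) /=.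
rewrite !big_ord_recl !big_ord0 !big_cons !big_nil /=.
by rewrite !mul1r !mulr1.
Qed.

Lemma coef_zint (a b c e f : A * A) (k : 'I_6) :
  (zint (fun j : 'I_5 => nth (0, 0) [:: a; b; c; e; f] j))`_(5 - k) =
  nth 0 (lprod [:: zroot b c e f; zroot a c e f; zroot a b e f; zroot a b c f;
                   zroot a b c e]) k.
Proof.
rewrite zintE.
under eq_bigr => r _ do rewrite -[r.1%:P]mulr1 mul_polyC.
rewrite lprodE coef_sum (bigD1 k) //= big1 ?addr0.
  by rewrite coefZ expr1n mulr1 coefXn eqxx mulr1.
move=> j ne; rewrite coefZ expr1n mulr1 coefXn; case: eqP => [e'|]; last by rewrite mulr0.
by case/eqP: ne; apply: val_inj; rewrite -[LHS](subKn (leq_ord j)) -e' subKn ?leq_ord.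
Qed.

End RootFormulas.

Section QuinticRoots.
Variable K : numClosedFieldType.
Implicit Types (g : 'M[K]_2) (l m : K * K).

(** The pair (l.2, -l.1) holds the coefficients of [linform l]; it is transformed as such and turned
    back into a root. *)
Definition gl_root g l : K * K :=
  let w := vmulmx (l.2, - l.1) (invmx g) in (- w.2, w.1).

Lemma gl_act_linform g l : gl_act g (linform l) = linform (gl_root g l).
Proof.
by rewrite !linformE -!scaleNr -[RHS]/(lin (_, - - _)) opprK -[_ + _]/(lin (l.2, -
    l.1)) gl_act_lin.
Qed.

Lemma bracket_gl_root g l m :
  bracket (gl_root g l) (gl_root g m) = \det (invmx g) * bracket l m.
Proof.
rewrite /gl_root /vmulmx /bracket /= (expand_det_row _ ord0) sum_I2 /cofactor !det_mx11
    !mxE.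
rewrite (_ : lift ord0 _ = ord_max); last exact: val_inj.
rewrite (_ : lift ord_max _ = ord0); last exact: val_inj.
by rewrite /= expr0 expr1; ring.
Qed.

Lemma gl_act_quintic g (l : 'I_5 -> K * K) :
  gl_act g (quintic l) = quintic (fun j => gl_root g (l j)).
Proof. by rewrite gl_act_prod; apply: eq_bigr => j _; rewrite gl_act_linform. Qed.

Lemma fun5E (T : Type) (x : T) (l : 'I_5 -> T) :
  l =1 fun j : 'I_5 => nth x [:: l (inord 0); l (inord 1); l (inord 2);
                               l (inord 3); l (inord 4)] j.
Proof.
by case=> -[|[|[|[|[|//]]]]] lt /=; congr l; apply: val_inj; rewrite /= inordK.
Qed.

(** The roots enter only through brackets, which are multiplied by the determinant of the inverse
    substitution. *)
Lemma zint_gl_root g (l : 'I_5 -> K * K) : \det g = 1 ->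
  zint (fun j => gl_root g (l j)) = zint l.
Proof.
move=> dg; rewrite [RHS](eq_zint (fun5E (0, 0) l)).
rewrite (eq_zint (fun5E (0, 0) (fun j => gl_root g (l j)))) !zintE.
by rewrite /zroot !bracket_gl_root det_inv dg invr1 !mul1r.
Qed.

Lemma quintic_nth (s : seq (K * K)) : size s = 5 ->
  quintic (fun j => nth (0, 0) s j) = \prod_(l <- s) linform l.
Proof. by move=> s5; rewrite /quintic (big_nth (0, 0)) s5 big_mkord. Qed.

Lemma bcoefK_quintic (l : 'I_5 -> K * K) : bform (bcoef (p := 5) (quintic l)) = quintic l.
Proof.
rewrite (eq_quintic (fun5E (0, 0) l)) quintic_nth //.
set s := [:: _; _; _; _; _]; rewrite /bform.
transitivity (\sum_(i < 6) nth 0 (lprod s) i *: 'X_[K, mon 5 i]).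
  by apply: eq_bigr => i _; congr (_ *: _); apply: bcoef_prod.
under [RHS]eq_bigr => i _ do rewrite linformE.
rewrite lprodE; apply: eq_bigr => i _.
by rewrite /mon mpolyXD !mpolyXn.
Qed.

(** The nonzero leading coefficient gives a polynomial of degree exactly 5 and is absorbed into the
    first root. Such quintics are dense, which is enough for [eq_on_split]. *)
Lemma quintic_split (a : 'I_6 -> K) : a ord0 != 0 ->
  exists l : 'I_5 -> K * K, a =1 bcoef (quintic l).
Proof.
move=> nz; pose p : {poly K} := \poly_(i < 6) a (inord (5 - i)).
have lp : p`_5 = a ord0.
  by rewrite coef_poly /=; congr a; apply: val_inj; rewrite /= inordK.
have sp : size p = 6.
  apply: size_poly_eq; rewrite (_ : inord _ = ord0) //.
  by apply: val_inj; rewrite /= inordK.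
have [r pE] := closed_field_poly_normal p.
have lcp : lead_coef p = a ord0 by rewrite lead_coefE sp.
have sr : size r = 5.
  have := sp; rewrite pE lcp size_scale // size_prod_XsubC.
  by case=> ->.
case: r sr pE => [//|z r] [sr]; rewrite lcp => pE.
pose s := (a ord0 * z, a ord0) :: [seq (x, 1) | x <- r].
have ss : size s = 5 by rewrite /= size_map sr.
exists (fun j => nth (0, 0) s j) => i.
rewrite quintic_nth // bcoef_prod //.
have {}pE : p = \prod_(l <- s) (l.2 *: 'X - l.1 *: 1).
  rewrite pE !big_cons big_map /= scalerAl; congr (_ * _).
    by rewrite scalerBr -!mul_polyC mulr1 -polyCM.
  by apply: eq_bigr => x _; rewrite /= scale1r -mul_polyC mulr1.
have -> : a i = p`_(5 - i).
  rewrite coef_poly (_ : (5 - i < 6)%N); last by rewrite ltnS leq_subr.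
  by rewrite subKn ?leq_ord // inord_val.
rewrite pE lprodE ss coef_sum (bigD1 i) //= big1 ?addr0.
  by rewrite coefZ expr1n mulr1 coefXn eqxx mulr1.
move=> j ne; rewrite coefZ expr1n mulr1 coefXn; case: eqP => [e'|]; last by rewrite mulr0.
by case/eqP: ne; apply: val_inj; rewrite /= -[LHS](subKn (leq_ord j)) -e' subKn ?leq_ord.
Qed.

Section CalB.
Variables (k : 'I_6) (B : {mpoly K[6]}).
Hypothesis hB : forall l : 'I_5 -> K * K,
  B.@[bcoef (quintic l)] = (calB_poly l)`_(5 - k).

Let eq_on_split p q : (forall l : 'I_5 -> K * K,
    p.@[bcoef (quintic l)] = q.@[bcoef (quintic l)]) ->
  p = q :> {mpoly K[6]}.
Proof.
move=> pq; apply: (@mpoly_eq_dense _ _ 'X_ord0) => [|a].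
  by apply/eqP => /(congr1 (meval (fun=> 1))) /eqP; rewrite mevalXU meval0 oner_eq0.
by rewrite mevalXU => /quintic_split [l aE]; rewrite !(meval_eq _ aE).
Qed.

Lemma calB_sl2_invariant : sl2_invariant B.
Proof.
move=> g dg a.
(* Writing the action on coefficients as a polynomial map makes the transformed [B] a polynomial, so
   it can be compared with [B] on split quintics alone. *)
pose X (i : 'I_6) : {mpoly K[6]} := \sum_(j < 6) bcoef (p := 5) (gl_act g 'X_[mon 5 j])
    i *: 'X_j.
have XE i b : (X i).@[b] = bcoef (gl_act g (bform b)) i.
  rewrite /bform gl_act_sum /X /bcoef !raddf_sum; apply: eq_bigr => j _.
  by rewrite /= mevalZ mevalXU gl_actZ mcoeffZ mulrC.
have E b : (B \mPo [tuple X i | i < 6]).@[b] = B.@[bcoef (gl_act g (bform b))].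
  by rewrite comp_mpoly_meval; apply: meval_eq => i; rewrite tnth_mktuple XE.
rewrite -E; congr (meval _ _); apply: eq_on_split => l.
rewrite E bcoefK_quintic gl_act_quintic !hB !calB_polyE.
by rewrite (zint_gl_root _ dg).
Qed.

Lemma calB_homog : B \is 24.-homog.
Proof.
apply: dhomog_meval => a.
pose X (i : 'I_6) : {mpoly K[6]} := 2 *: 'X_i.
have E b : (B \mPo [tuple X i | i < 6]).@[b] = B.@[fun i => 2 * b i].
  by rewrite comp_mpoly_meval; apply: meval_eq => i; rewrite tnth_mktuple mevalZ mevalXU.
rewrite -E -mevalZ; congr (meval _ _); apply: eq_on_split => l.
(* Doubling a single root doubles the quintic and multiplies [zint] by 2^24. *)
pose c (j : 'I_5) : K := if j == ord0 then 2 else 1.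
have cE : \prod_j c j = 2 by rewrite big_ord_recl big1 ?mulr1.
rewrite E mevalZ hB.
have -> : B.@[fun i => 2 * bcoef (quintic l) i] =
    B.@[bcoef (quintic (fun j => (c j * (l j).1, c j * (l j).2)))].
  by apply: meval_eq => i; rewrite quintic_scale cE /bcoef mcoeffZ.
by rewrite hB !calB_polyE zint_scale cE !coefZ mulrCA.
Qed.

End CalB.
End QuinticRoots.

(** * Interpolation of the B_k *)

Section WeightSix.
Variable A : comNzRingType.

(* x, y, z have weights 1, 2, 3; they stand for I4, 2^7 I8 and 2^11 I12. *)
Definition wt6 (c : seq A) (x y z : A) : A :=
  c`_0 * x ^+ 6 + c`_1 * (x ^+ 4 * y) + c`_2 * (x ^+ 2 * y ^+ 2) + c`_3 * y ^+ 3
  + c`_4 * (x ^+ 3 * z) + c`_5 * (x * y * z) + c`_6 * z ^+ 2.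

Definition wt6_comb (c e : seq A) (x y : A) : seq A :=
  mkseq (fun i => x * c`_i - y * e`_i) 7.

Lemma wt6_linear c e s t x y z :
  wt6 (wt6_comb c e s t) x y z = s * wt6 c x y z - t * wt6 e x y z.
Proof. by rewrite /wt6 /wt6_comb /=; ring. Qed.

End WeightSix.

Section Interpolation.
Variable K : numFieldType.

(* Values of (I4, 2^7 I8, 2^11 I12) at seven quintics with rational roots; the
   first three have discriminant I4^2 - 2^7 I8 = 0. *)
Definition sample_points : seq (K * K * K) :=
  [:: (- 32 / (5 ^+ 4), 2 ^+ 10 / (5 ^+ 8), - 2 ^+ 15 / (5 ^+ 12));
      (- 24 / (5 ^+ 4), 576 / (5 ^+ 8), - 2 ^+ 10 / (5 ^+ 12));
      (- 56 / (5 ^+ 4), 2 ^+ 6 * 7 ^+ 2 / (5 ^+ 8), - 2 ^+ 10 * 59 / (5 ^+ 12));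
      (- 24 / (5 ^+ 2), 576 / (5 ^+ 5), - 512 / (5 ^+ 7));
      (- 62 / (5 ^+ 2), 2 ^+ 2 * 11 ^+ 2 * 29 / (5 ^+ 5), - 2 ^+ 4 * 11 ^+ 4 / (5 ^+ 7));
      (- 728 / (5 ^+ 2), 2 ^+ 6 * 7 ^+ 2 * 521 / (5 ^+ 5), - 2 ^+ 9 * 13 * 139 * 191 /
          (5 ^+ 7));
      (- 54, ((6 * 1000 + 826) * 1000 + 356) / (5 ^+ 5), - ((26 * 1000 + 162) * 1000 +
          352) / (5 ^+ 5))].

(** On the discriminant y = x^2 only c0 + c1 + c2 + c3, c4 + c5 and c6 are visible, and the first
    three points determine them. The other four points settle the rest. *)
Lemma wt6_interpolation (c : seq K) : size c = 7 ->
  (forall p, p \in sample_points -> wt6 c p.1.1 p.1.2 p.2 = 0) ->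
  forall x y z, wt6 c x y z = 0.
Proof.
case: c => [|c0 [|c1 [|c2 [|c3 [|c4 [|c5 [|c6 [|//]]]]]]]] // _ H.
have h0 : (c0 + c1 + c2 + c3) + (c4 + c5) + c6 = 0.
  have /H : nth (0, 0, 0) sample_points 0 \in sample_points by apply: mem_nth.
  (* The factor common to the values of the monomials is cancelled, leaving an equation with small
     integer coefficients. *)
  rewrite /wt6 /= => E; apply: (@mulfI _ (2 ^+ 30 / (5 ^+ 24))).
    by rewrite !(mulf_eq0, expf_eq0, invr_eq0, pnatr_eq0, oner_eq0).
  by rewrite mulr0 -E; field.
have h1 : 729 * (c0 + c1 + c2 + c3) + 54 * (c4 + c5) + 4 * c6 = 0.
  have /H : nth (0, 0, 0) sample_points 1 \in sample_points by apply: mem_nth.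
  rewrite /wt6 /= => E; apply: (@mulfI _ (2 ^+ 18 / (5 ^+ 24))).
    by rewrite !(mulf_eq0, expf_eq0, invr_eq0, pnatr_eq0, oner_eq0).
  by rewrite mulr0 -E; field.
have h2 : (7 ^+ 6) * (c0 + c1 + c2 + c3) + (2 * 7 ^+ 3 * 59) * (c4 + c5) + (2 ^+ 2 * 59
    ^+ 2) * c6 = 0.
  have /H : nth (0, 0, 0) sample_points 2 \in sample_points by apply: mem_nth.
  rewrite /wt6 /= => E; apply: (@mulfI _ (2 ^+ 18 / (5 ^+ 24))).
    by rewrite !(mulf_eq0, expf_eq0, invr_eq0, pnatr_eq0, oner_eq0).
  by rewrite mulr0 -E; field.
have s03 : c0 + c1 + c2 + c3 = 0.
  have nz : (281 * 1000 + 250)%N%:R != 0 :> K by rewrite pnatr_eq0 ?(muln_eq0,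
      addn_eq0) /= ?andbF.
  (* The multipliers eliminate the other unknowns, as a row of the inverse matrix cleared of
     denominators; [nz] concerns the coefficient that survives. The later eliminations follow the
     same pattern. *)
  apply: (mulfI nz); transitivity (
    (2 ^+ 3 * 5 ^+ 2 * 59)
      * ((c0 + c1 + c2 + c3) + (c4 + c5) + c6)
    + 531
      * (729 * (c0 + c1 + c2 + c3) + 54 * (c4 + c5) + 4 * c6)
    + (- 1)
      * ((7 ^+ 6) * (c0 + c1 + c2 + c3) + (2 * 7 ^+ 3 * 59) * (c4 + c5) + (2 ^+ 2 * 59
          ^+ 2) * c6)); first by ring.
  by rewrite h0 h1 h2 !mulr0 ?addr0.
have s45 : c4 + c5 = 0.
  have nz : (562 * 1000 + 500)%N%:R != 0 :> K by rewrite pnatr_eq0 ?(muln_eq0,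
      addn_eq0) /= ?andbF.
  apply: (mulfI nz); transitivity (
    (- 2 ^+ 7 * 5 ^+ 2 * 11 ^+ 2)
      * ((c0 + c1 + c2 + c3) + (c4 + c5) + c6)
    + (- 3 ^+ 2 * 461)
      * (729 * (c0 + c1 + c2 + c3) + 54 * (c4 + c5) + 4 * c6)
    + 29
      * ((7 ^+ 6) * (c0 + c1 + c2 + c3) + (2 * 7 ^+ 3 * 59) * (c4 + c5) + (2 ^+ 2 * 59
          ^+ 2) * c6)); first by ring.
  by rewrite h0 h1 h2 !mulr0 ?addr0.
have z6 : c6 = 0.
  have nz : (62 * 1000 + 500)%N%:R != 0 :> K by rewrite pnatr_eq0 ?(muln_eq0, addn_eq0)
      /= ?andbF.
  apply: (mulfI nz); transitivity (
    (2 ^+ 2 * 3 * 5 ^+ 2 * 7 ^+ 3)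
      * ((c0 + c1 + c2 + c3) + (c4 + c5) + c6)
    + 343
      * (729 * (c0 + c1 + c2 + c3) + 54 * (c4 + c5) + 4 * c6)
    + (- 3)
      * ((7 ^+ 6) * (c0 + c1 + c2 + c3) + (2 * 7 ^+ 3 * 59) * (c4 + c5) + (2 ^+ 2 * 59
          ^+ 2) * c6)); first by ring.
  by rewrite h0 h1 h2 !mulr0 ?addr0.
(* The form is now (x^2 - y) times c0 x^4 + (c0 + c1) x^2 y + (c0 + c1 + c2) y^2 + c4 x z. The four
   coefficients of this quotient are the unknowns of the remaining 4 x 4 system. *)
have e3 : c3 = - (c0 + c1 + c2) by apply/eqP; rewrite -addr_eq0 addrC s03.
have e5 : c5 = - c4 by apply/eqP; rewrite -addr_eq0 addrC s45.
have h3 : 675 * c0 + 135 * (c0 + c1) + 27 * (c0 + c1 + c2) + 5 * c4 = 0.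
  have /H : nth (0, 0, 0) sample_points 3 \in sample_points by apply: mem_nth.
  rewrite /wt6 /= e3 e5 z6 => E; apply: (@mulfI _ (2 ^+ 20 * 3 ^+ 3 / (5 ^+ 15))).
    by rewrite !(mulf_eq0, expf_eq0, invr_eq0, pnatr_eq0, oner_eq0).
  by rewrite mulr0 -E; field.
have h4 : (5 ^+ 2 * 31 ^+ 4) * c0 + (5 * 11 ^+ 2 * 29 * 31 ^+ 2) * (c0 + c1)
    + (11 ^+ 4 * 29 ^+ 2) * (c0 + c1 + c2) + (2 * 5 * 11 ^+ 4 * 31) * c4 = 0.
  have /H : nth (0, 0, 0) sample_points 4 \in sample_points by apply: mem_nth.
  rewrite /wt6 /= e3 e5 z6 => E; apply: (@mulfI _ (2 ^+ 10 * 3 ^+ 4 / (5 ^+ 15))).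
    by rewrite !(mulf_eq0, expf_eq0, invr_eq0, pnatr_eq0, oner_eq0).
  by rewrite mulr0 -E; field.
have h5 : (5 ^+ 2 * 7 ^+ 3 * 13 ^+ 4) * c0 + (5 * 7 ^+ 3 * 13 ^+ 2 * 521) * (c0 + c1)
    + (7 ^+ 3 * 521 ^+ 2) * (c0 + c1 + c2) + (5 * 13 ^+ 2 * 139 * 191) * c4 = 0.
  have /H : nth (0, 0, 0) sample_points 5 \in sample_points by apply: mem_nth.
  rewrite /wt6 /= e3 e5 z6 => E; apply: (@mulfI _ (2 ^+ 20 * 3 ^+ 4 * 7 ^+ 3 / (5 ^+
      15))).
    by rewrite !(mulf_eq0, expf_eq0, invr_eq0, pnatr_eq0, oner_eq0).
  by rewrite mulr0 -E; field.
have h6 : (3 ^+ 3 * 5 ^+ 10) * c0 + ((197 * 1000 + 521) * 1000 + 875) * (c0 + c1)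
    + ((147 * 1000 + 967) * 1000 + 587) * (c0 + c1 + c2)
    + ((14 * 1000 + 18) * 1000 + 750) * c4 = 0.
  have /H : nth (0, 0, 0) sample_points 6 \in sample_points by apply: mem_nth.
  rewrite /wt6 /= e3 e5 z6 => E; apply: (@mulfI _ (2 ^+ 10 * 3 ^+ 15 * 7 ^+ 2 / (5 ^+
      15))).
    by rewrite !(mulf_eq0, expf_eq0, invr_eq0, pnatr_eq0, oner_eq0).
  by rewrite mulr0 -E; field.
have z0 : c0 = 0.
  have nz : (((((6 * 1000 + 417) * 1000 + 11) * 1000 + 568) * 1000 + 240) * 1000)%N%:R
      != 0 :> K by rewrite pnatr_eq0 ?(muln_eq0, addn_eq0) /= ?andbF.
  apply: (mulfI nz); transitivity (
    ((((19 * 1000 + 289) * 1000 + 817) * 1000 + 12) * 1000 + 715)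
      * (675 * c0 + 135 * (c0 + c1) + 27 * (c0 + c1 + c2) + 5 * c4)
    + (2 ^+ 3 * 13 * 79 * 89 * 401)
      * ((5 ^+ 2 * 31 ^+ 4) * c0 + (5 * 11 ^+ 2 * 29 * 31 ^+ 2) * (c0 + c1)
        + (11 ^+ 4 * 29 ^+ 2) * (c0 + c1 + c2) + (2 * 5 * 11 ^+ 4 * 31) * c4)
    + (- ((76 * 1000 + 95) * 1000 + 383))
      * ((5 ^+ 2 * 7 ^+ 3 * 13 ^+ 4) * c0 + (5 * 7 ^+ 3 * 13 ^+ 2 * 521) * (c0 + c1)
        + (7 ^+ 3 * 521 ^+ 2) * (c0 + c1 + c2) + (5 * 13 ^+ 2 * 139 * 191) * c4)
    + (2 ^+ 6 * 5 * 7 ^+ 2 * 19 * 67)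
      * ((3 ^+ 3 * 5 ^+ 10) * c0 + ((197 * 1000 + 521) * 1000 + 875) * (c0 + c1)
        + ((147 * 1000 + 967) * 1000 + 587) * (c0 + c1 + c2)
        + ((14 * 1000 + 18) * 1000 + 750) * c4)); first by ring.
  by rewrite h3 h4 h5 h6 !mulr0 ?addr0.
have s01 : c0 + c1 = 0.
  have nz : ((((((1 * 1000 + 164) * 1000 + 687) * 1000 + 599) * 1000 + 635) * 1000 +
      560) * 1000)%N%:R != 0 :> K by rewrite pnatr_eq0 ?(muln_eq0, addn_eq0) /= ?andbF.
  apply: (mulfI nz); transitivity (
    (- (((((10 * 1000 + 412) * 1000 + 510) * 1000 + 919) * 1000 + 803) * 1000 + 715))
      * (675 * c0 + 135 * (c0 + c1) + 27 * (c0 + c1 + c2) + 5 * c4)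
    + (- (((346 * 1000 + 291) * 1000 + 652) * 1000 + 564))
      * ((5 ^+ 2 * 31 ^+ 4) * c0 + (5 * 11 ^+ 2 * 29 * 31 ^+ 2) * (c0 + c1)
        + (11 ^+ 4 * 29 ^+ 2) * (c0 + c1 + c2) + (2 * 5 * 11 ^+ 4 * 31) * c4)
    + (((87 * 1000 + 649) * 1000 + 352) * 1000 + 63)
      * ((5 ^+ 2 * 7 ^+ 3 * 13 ^+ 4) * c0 + (5 * 7 ^+ 3 * 13 ^+ 2 * 521) * (c0 + c1)
        + (7 ^+ 3 * 521 ^+ 2) * (c0 + c1 + c2) + (5 * 13 ^+ 2 * 139 * 191) * c4)
    + (- (((24 * 1000 + 434) * 1000 + 225) * 1000 + 340))
      * ((3 ^+ 3 * 5 ^+ 10) * c0 + ((197 * 1000 + 521) * 1000 + 875) * (c0 + c1)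
        + ((147 * 1000 + 967) * 1000 + 587) * (c0 + c1 + c2)
        + ((14 * 1000 + 18) * 1000 + 750) * c4)); first by ring.
  by rewrite h3 h4 h5 h6 !mulr0 ?addr0.
have s02 : c0 + c1 + c2 = 0.
  have nz : ((((286 * 1000 + 692) * 1000 + 332) * 1000 + 217) * 1000 + 984)%N%:R != 0
      :> K by rewrite pnatr_eq0 ?(muln_eq0, addn_eq0) /= ?andbF.
  apply: (mulfI nz); transitivity (
    ((((1 * 1000 + 882) * 1000 + 975) * 1000 + 940) * 1000 + 625)
      * (675 * c0 + 135 * (c0 + c1) + 27 * (c0 + c1 + c2) + 5 * c4)
    + (2 ^+ 5 * 5 ^+ 3 * 11 ^+ 2 * 13 ^+ 2)
      * ((5 ^+ 2 * 31 ^+ 4) * c0 + (5 * 11 ^+ 2 * 29 * 31 ^+ 2) * (c0 + c1)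
        + (11 ^+ 4 * 29 ^+ 2) * (c0 + c1 + c2) + (2 * 5 * 11 ^+ 4 * 31) * c4)
    + (- 5 ^+ 3 * 7 ^+ 3 * 17 * 31)
      * ((5 ^+ 2 * 7 ^+ 3 * 13 ^+ 4) * c0 + (5 * 7 ^+ 3 * 13 ^+ 2 * 521) * (c0 + c1)
        + (7 ^+ 3 * 521 ^+ 2) * (c0 + c1 + c2) + (5 * 13 ^+ 2 * 139 * 191) * c4)
    + (2 ^+ 3 * 3 * 7 ^+ 2 * 13 * 19 * 31)
      * ((3 ^+ 3 * 5 ^+ 10) * c0 + ((197 * 1000 + 521) * 1000 + 875) * (c0 + c1)
        + ((147 * 1000 + 967) * 1000 + 587) * (c0 + c1 + c2)
        + ((14 * 1000 + 18) * 1000 + 750) * c4)); first by ring.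
  by rewrite h3 h4 h5 h6 !mulr0 ?addr0.
have z4 : c4 = 0.
  have nz : ((((4 * 1000 + 232) * 1000 + 395) * 1000 + 777) * 1000 + 500)%N%:R != 0 :>
      K by rewrite pnatr_eq0 ?(muln_eq0, addn_eq0) /= ?andbF.
  apply: (mulfI nz); transitivity (
    (2 ^+ 3 * 3 * 5 * 7 * 17 * 19 * 37 * 43)
      * (675 * c0 + 135 * (c0 + c1) + 27 * (c0 + c1 + c2) + 5 * c4)
    + (7 * 11 ^+ 2 * 37 * 43)
      * ((5 ^+ 2 * 31 ^+ 4) * c0 + (5 * 11 ^+ 2 * 29 * 31 ^+ 2) * (c0 + c1)
        + (11 ^+ 4 * 29 ^+ 2) * (c0 + c1 + c2) + (2 * 5 * 11 ^+ 4 * 31) * c4)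
    + (- 2 ^+ 3 * 13 ^+ 2 * 17)
      * ((5 ^+ 2 * 7 ^+ 3 * 13 ^+ 4) * c0 + (5 * 7 ^+ 3 * 13 ^+ 2 * 521) * (c0 + c1)
        + (7 ^+ 3 * 521 ^+ 2) * (c0 + c1 + c2) + (5 * 13 ^+ 2 * 139 * 191) * c4)
    + (- 3 * 5 * 7 ^+ 3 * 19)
      * ((3 ^+ 3 * 5 ^+ 10) * c0 + ((197 * 1000 + 521) * 1000 + 875) * (c0 + c1)
        + ((147 * 1000 + 967) * 1000 + 587) * (c0 + c1 + c2)
        + ((14 * 1000 + 18) * 1000 + 750) * c4)); first by ring.
  by rewrite h3 h4 h5 h6 !mulr0 ?addr0.
have z1 : c1 = 0 by rewrite -[LHS]add0r -z0 s01.
have z2 : c2 = 0 by rewrite -[LHS]add0r -s01 s02.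
have z3 : c3 = 0 by rewrite e3 s02 oppr0.
have z5 : c5 = 0 by rewrite e5 z4 oppr0.
by move=> x y z; rewrite /wt6 /= z0 z1 z2 z3 z4 z5 z6 !mul0r !addr0.
Qed.

End Interpolation.

(* 3^(3k) 2^40 B_k = 5^15 (sum of calB_row k against the monomials of wt6); row 0
   is the cube of the discriminant x^2 - y. *)
Definition calB_row (A : comNzRingType) (k : nat) : seq A := nth [::]
  [:: [:: 1; - 3; 3; - 1; 0; 0; 0];
      [:: - 160; 355; - 230; 35; 0; 0; 0];
      [:: 2 ^+ 11 * 5; - 2 ^+ 3 * 3 * 5 * 131; 2 ^+ 3 * 5 * 11 * 13; - 240; - 2 ^+ 3 *
          5 ^+ 4; 2 ^+ 3 * 5 ^+ 4; 0];
      [:: - 2 ^+ 16 * 5; 2 ^+ 8 * 3 ^+ 5 * 5; - 2 ^+ 3 * 5 * 23 * 37; 680; 2 ^+ 5 * 5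
          ^+ 4 * 11; - 2 ^+ 6 * 3 * 5 ^+ 4; - 2 ^+ 4 * 5 ^+ 5];
      [:: 2 ^+ 20 * 5; - 2 ^+ 13 * 5 * 59; - 2 ^+ 4 * 5 * 7 ^+ 2 * 83; - 880; - 2 ^+ 7
          * 5 ^+ 4 * 29; - 2 ^+ 5 * 3 ^+ 2 * 5 ^+ 4; 0];
      [:: - 2 ^+ 25; 2 ^+ 18 * 3 ^+ 2; - 2 ^+ 11 * 3 ^+ 3; 432; 0; 0; 0]] k.

Section CalBFormula.
Variable K : numClosedFieldType.

Lemma wt6_supp (P : {mpoly K[3]}) :
  (forall m, m \in msupp P -> (4 * m 0%R + 8 * m 1%R + 12 * m 2%R = 24)%N) ->
  exists2 c : seq K, size c = 7 &
    forall v, P.@[v] = wt6 c (v 0) (2 ^+ 7 * v 1) (2 ^+ 11 * v 2%R).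
Proof.
move=> wP; pose M (t : nat * nat * nat) : 'X_{1..3} :=
  [multinom nth 0%N [:: t.1.1; t.1.2; t.2] i | i < 3].
pose T := [:: (6, 0, 0); (4, 1, 0); (2, 2, 0); (0, 3, 0); (3, 0, 1); (1, 1, 1); (0, 0,
    2)]%N.
have PE : P = \sum_(t <- T) P@_(M t) *: 'X_[M t].
  have M_inj : injective M.
    move=> [[i j] k] [[i' j'] k'] /mnmP E.
    by have := E 0; have := E 1; have := E 2%R; rewrite !mnmE /= => -> -> ->.
  apply/mpolyP => m; rewrite raddf_sum /=.
  under eq_bigr do rewrite mcoeffZ mcoeffX.
  have mE : m = M (m 0, m 1, m 2%R).
    apply/mnmP => -[[|[|[|//]]] lt]; rewrite mnmE /=; congr (m _); exact: val_inj.
  have [mT|mT] := boolP ((m 0, m 1, m 2%R) \in T).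
    rewrite (bigD1_seq (m 0, m 1, m 2%R)) //= -mE eqxx mulr1 big1 ?addr0 // => t ne.
    by rewrite {1}mE (inj_eq M_inj) (negPf ne) mulr0.
  rewrite big_seq big1 => [|t tT].
    apply/eqP; rewrite mcoeff_eq0; apply: contraNN mT => /wP.
    move: (m 0) (m 1) (m 2%R) => i j k E.
    have [kE jE] : (k <= 2)%N /\ (j <= 3)%N by split; lia.
    have -> : i = (6 - 2 * j - 3 * k)%N by lia.
    have : (2 * j + 3 * k <= 6)%N by lia.
    by move: j jE k kE {E} => [|[|[|[|//]]]] _ [|[|[|//]]] _.
  rewrite mE (inj_eq M_inj); case: eqP => [e|]; last by rewrite mulr0.
  by rewrite -e tT in mT.
have nz2 : 2 != 0 :> K by rewrite pnatr_eq0.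
(* A monomial with exponents j and k in the last two variables is divided by 2^(7j + 11k), undoing
   the scaling of y and z. *)
exists [:: P@_(M (6, 0, 0)); P@_(M (4, 1, 0)) / 2 ^+ 7; P@_(M (2, 2, 0)) / 2 ^+ 14;
  P@_(M (0, 3, 0)) / 2 ^+ 21; P@_(M (3, 0, 1)) / 2 ^+ 11;
  P@_(M (1, 1, 1)) / 2 ^+ 18; P@_(M (0, 0, 2)) / 2 ^+ 22]%N => //.
move=> v; rewrite {1}PE /T !big_cons big_nil !mevalD meval0 !mevalZ !mevalX
    !big_ord_recl !big_ord0.
rewrite (_ : lift ord0 (lift ord0 ord0) = 2%R); last exact: val_inj.
rewrite (_ : lift ord0 ord0 = 1); last exact: val_inj.
rewrite (_ : ord0 = 0); last exact: val_inj.
rewrite !mnmE /wt6 /=.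
move: (P@__) (P@__) (P@__) (P@__) (P@__) (P@__) (P@__) (v 0) (v 1) (v 2%R) nz2 => *.
by field.
Qed.

Section Sample.
Variables (k : 'I_6) (B : {mpoly K[6]}) (c : seq K).
Hypotheses (hB : forall l : 'I_5 -> K * K, B.@[bcoef (quintic l)] = (calB_poly l)`_(5 -
    k))
  (cE : forall a, B.@[a] = wt6 c (I4 (ncoef a)) (2 ^+ 7 * I8 (ncoef a))
                              (2 ^+ 11 * I12 (ncoef a))).

(** Each z_i belongs to the quartic omitting the root s_i, and [a] holds the coefficients without
    binomials. Supplying all of them as literals splits a sample into small independent
    verifications. *)
Lemma sample_eval (s0 s1 s2 s3 s4 z0 z1 z2 z3 z4 : K * K) (a : seq K) (x y z : K) :
  lprod [:: s0; s1; s2; s3; s4] = mkseq (fun i => 'C(5, i)%:R * a`_i) 6 ->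
  [/\ I4 (nth 0 a) = x, 2 ^+ 7 * I8 (nth 0 a) = y & 2 ^+ 11 * I12 (nth 0 a) = z] ->
  [/\ zroot s1 s2 s3 s4 = z0, zroot s0 s2 s3 s4 = z1, zroot s0 s1 s3 s4 = z2,
      zroot s0 s1 s2 s4 = z3 & zroot s0 s1 s2 s3 = z4] ->
  wt6 c x y z = (2 ^+ 8 * 3 ^+ 3) ^- 5 * nth 0 (lprod [:: z0; z1; z2; z3; z4]) k.
Proof.
move=> sE [<- <- <-] [<- <- <- <- <-].
have bE i : (i < 6)%N ->
    ncoef (bcoef (quintic (fun j => nth (0, 0) [:: s0; s1; s2; s3; s4] j))) i = a`_i.
  move=> i6; rewrite /ncoef quintic_nth // bcoef_prod // inordK // sE nth_mkseq //.
  by rewrite mulrC mulKf // pnatr_eq0 -lt0n bin_gt0.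
have E := cE (bcoef (quintic (fun j => nth (0, 0) [:: s0; s1; s2; s3; s4] j))).
move: E; rewrite /I4 /I8 /I12 /cov0 /cov1 /cov2 /can0 /can1 /can2 /can3 /det3 !bE // =>
    <-.
rewrite hB calB_polyE coefZ coef_zint; congr (_ ^- 5 * _).
by rewrite (_ : 6912%N = (2 ^ 8 * 3 ^ 3)%N) ?natrM ?natrX //; vm_compute.
Qed.

End Sample.
End CalBFormula.

Section CalBExplicit.
Variables (K : numClosedFieldType) (k : 'I_6) (B : {mpoly K[6]}).
Hypothesis hB : forall l : 'I_5 -> K * K, B.@[bcoef (quintic l)] = (calB_poly l)`_(5 - k).

Lemma calB_formula a : 3 ^+ (3 * k) * 2 ^+ 40 * B.@[a] =
  5 ^+ 15 * wt6 (calB_row K k) (I4 (ncoef a)) (2 ^+ 7 * I8 (ncoef a))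
                               (2 ^+ 11 * I12 (ncoef a)).
Proof.
have [P BE wP] := sl2_invariant_generators (calB_sl2_invariant hB) (calB_homog hB) isT.
have [c sc cE] := wt6_supp wP.
have {}cE b : B.@[b] = wt6 c (I4 (ncoef b)) (2 ^+ 7 * I8 (ncoef b))
                            (2 ^+ 11 * I12 (ncoef b)).
  by rewrite BE meval_I_tuple cE.
apply/eqP; rewrite -subr_eq0 cE -wt6_linear; apply/eqP.
apply: wt6_interpolation => [|p]; first exact: size_mkseq.
rewrite /sample_points !inE wt6_linear.
have binE : (('C(5, 0) = 1) * ('C(5, 1) = 5) * ('C(5, 2) = 10) *
  ('C(5, 3) = 10) * ('C(5, 4) = 5) * ('C(5, 5) = 1))%type by [].
have ev := sample_eval hB cE.
case/or4P => [|||/or4P[]] /eqP -> {p} /=.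
(* The arguments are the five roots, the five pairs of the quartics, and the normalised
   coefficients. A quartic with a double root has second component 0. *)
- rewrite (@ev (1, 0) (1, 0) (- 4, 1) (- 4, 1) (0, 1)
    (2 ^+ 14, 0) (2 ^+ 14, 0) (4, 0) (4, 0) (4, 0)
    [:: 0; 0; 1 / (2 * 5); 4 / 5; 16 / 5; 0]).
  + by case: k => -[|[|[|[|[|[|//]]]]]] ? /=; rewrite /wt6 /=; field.
  + by rewrite /lprod /lstep /mkseq /= !binE; do ![congr (_ :: _)]; field.
  + rewrite /I4 /I8 /I12 /cov0 /cov1 /cov2 /can0 /can1 /can2 /can3 /det3 /=.
    by split; field.
  + by rewrite /zroot /bracket /=; split; congr (_, _); ring.
- rewrite (@ev (1, 0) (1, 0) (- 4, 1) (- 2, 1) (0, 1)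
    (2 ^+ 8 * 3 ^+ 3, 2 ^+ 8 * 3 ^+ 3) (2 ^+ 8 * 3 ^+ 3, 2 ^+ 8 * 3 ^+ 3) (4, 0) (4, 0)
        (4, 0)
    [:: 0; 0; 1 / (2 * 5); 3 / 5; 8 / 5; 0]).
  + by case: k => -[|[|[|[|[|[|//]]]]]] ? /=; rewrite /wt6 /=; field.
  + by rewrite /lprod /lstep /mkseq /= !binE; do ![congr (_ :: _)]; field.
  + rewrite /I4 /I8 /I12 /cov0 /cov1 /cov2 /can0 /can1 /can2 /can3 /det3 /=.
    by split; field.
  + by rewrite /zroot /bracket /=; split; congr (_, _); ring.
- rewrite (@ev (1, 0) (1, 0) (- 4, 1) (0, 1) (2, 1)
    (2 ^+ 8 * 7 ^+ 3, 2 ^+ 8 * 3 ^+ 5) (2 ^+ 8 * 7 ^+ 3, 2 ^+ 8 * 3 ^+ 5) (4, 0) (4, 0)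
        (4, 0)
    [:: 0; 0; 1 / (2 * 5); 1 / 5; - 8 / 5; 0]).
  + by case: k => -[|[|[|[|[|[|//]]]]]] ? /=; rewrite /wt6 /=; field.
  + by rewrite /lprod /lstep /mkseq /= !binE; do ![congr (_ :: _)]; field.
  + rewrite /I4 /I8 /I12 /cov0 /cov1 /cov2 /can0 /can1 /can2 /can3 /det3 /=.
    by split; field.
  + by rewrite /zroot /bracket /=; split; congr (_, _); ring.
- rewrite (@ev (1, 0) (- 4, 1) (- 3, 1) (- 2, 1) (0, 1)
    (2 ^+ 8 * 7 ^+ 3, 2 ^+ 8 * 3 ^+ 5) (2 ^+ 2 * 7 ^+ 3, 972) (2 ^+ 8 * 3 ^+ 3, 2 ^+ 8
        * 3 ^+ 3) (2 ^+ 2 * 13 ^+ 3, 2 ^+ 4 * 3 ^+ 5) (108, 108)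
    [:: 0; - 1 / 5; - 9 / (2 * 5); - 13 / 5; - 24 / 5; 0]).
  + by case: k => -[|[|[|[|[|[|//]]]]]] ? /=; rewrite /wt6 /=; field.
  + by rewrite /lprod /lstep /mkseq /= !binE; do ![congr (_ :: _)]; field.
  + rewrite /I4 /I8 /I12 /cov0 /cov1 /cov2 /can0 /can1 /can2 /can3 /det3 /=.
    by split; field.
  + by rewrite /zroot /bracket /=; split; congr (_, _); ring.
- rewrite (@ev (1, 0) (- 4, 1) (- 3, 1) (- 1, 1) (0, 1)
    (2 ^+ 2 * 73 ^+ 3, 2 ^+ 6 * 3 ^+ 7) (2 ^+ 2 * 7 ^+ 3, 972) (2 ^+ 2 * 13 ^+ 3, 2 ^+
        4 * 3 ^+ 5) (2 ^+ 2 * 13 ^+ 3, 2 ^+ 4 * 3 ^+ 5) (2 ^+ 2 * 7 ^+ 3, 972)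
    [:: 0; - 1 / 5; - 4 / 5; - 19 / (2 * 5); - 12 / 5; 0]).
  + by case: k => -[|[|[|[|[|[|//]]]]]] ? /=; rewrite /wt6 /=; field.
  + by rewrite /lprod /lstep /mkseq /= !binE; do ![congr (_ :: _)]; field.
  + rewrite /I4 /I8 /I12 /cov0 /cov1 /cov2 /can0 /can1 /can2 /can3 /det3 /=.
    by split; field.
  + by rewrite /zroot /bracket /=; split; congr (_, _); ring.
- rewrite (@ev (1, 0) (- 4, 1) (0, 1) (2, 1) (3, 1)
    (2 ^+ 8 * 67 ^+ 3, 2 ^+ 8 * 3 ^+ 7 * 7 ^+ 2) (2 ^+ 2 * 7 ^+ 3, 972) (2 ^+ 2 * 43 ^+
        3, 2 ^+ 2 * 3 ^+ 5 * 7 ^+ 2) (2 ^+ 2 * 37 ^+ 3, 2 ^+ 4 * 3 ^+ 5 * 7 ^+ 2) (2 ^+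
        8 * 7 ^+ 3, 2 ^+ 8 * 3 ^+ 5)
    [:: 0; - 1 / 5; 1 / (2 * 5); 7 / 5; - 24 / 5; 0]).
  + by case: k => -[|[|[|[|[|[|//]]]]]] ? /=; rewrite /wt6 /=; field.
  + by rewrite /lprod /lstep /mkseq /= !binE; do ![congr (_ :: _)]; field.
  + rewrite /I4 /I8 /I12 /cov0 /cov1 /cov2 /can0 /can1 /can2 /can3 /det3 /=.
    by split; field.
  + by rewrite /zroot /bracket /=; split; congr (_, _); ring.
- rewrite (@ev (1, 0) (- 4, 1) (- 3, 1) (0, 1) (3, 1)
    (2 ^+ 2 * 3 ^+ 9 * 19 ^+ 3, 2 ^+ 6 * 3 ^+ 9 * 7 ^+ 2) (2 ^+ 2 * 3 ^+ 9, 2 ^+ 2 * 3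
        ^+ 9) (2 ^+ 2 * 37 ^+ 3, 2 ^+ 4 * 3 ^+ 5 * 7 ^+ 2) (2 ^+ 2 * 43 ^+ 3, 2 ^+ 2 *
        3 ^+ 5 * 7 ^+ 2) (2 ^+ 2 * 13 ^+ 3, 2 ^+ 4 * 3 ^+ 5)
    [:: 0; - 1 / 5; - 2 / 5; 9 / (2 * 5); 36 / 5; 0]).
  + by case: k => -[|[|[|[|[|[|//]]]]]] ? /=; rewrite /wt6 /=; field.
  + by rewrite /lprod /lstep /mkseq /= !binE; do ![congr (_ :: _)]; field.
  + rewrite /I4 /I8 /I12 /cov0 /cov1 /cov2 /can0 /can1 /can2 /can3 /det3 /=.
    by split; field.
  + by rewrite /zroot /bracket /=; split; congr (_, _); ring.
Qed.

End CalBExplicit.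

(** * Monomials of weight divisible by 12 *)

Section Subalgebra.
Variables (K : numFieldType) (n m : nat) (T : n.-tuple {mpoly K[m]}).

Definition gen_by (J : {mpoly K[m]}) : Prop := exists P, J = P \mPo T.

Lemma gen_by_tnth i : gen_by (tnth T i).
Proof. by exists 'X_i; rewrite comp_mpolyXU -tnth_nth. Qed.

Lemma gen_by_nat k : gen_by k%:R.
Proof. by exists k%:R; rewrite rmorph_nat. Qed.

Lemma gen_byD J J' : gen_by J -> gen_by J' -> gen_by (J + J').
Proof. by move=> [P ->] [P' ->]; exists (P + P'); rewrite rmorphD. Qed.

Lemma gen_byN J : gen_by J -> gen_by (- J).
Proof. by move=> [P ->]; exists (- P); rewrite rmorphN. Qed.

Lemma gen_byM J J' : gen_by J -> gen_by J' -> gen_by (J * J').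
Proof. by move=> [P ->] [P' ->]; exists (P * P'); rewrite rmorphM. Qed.

Lemma gen_byX J k : gen_by J -> gen_by (J ^+ k).
Proof. by move=> [P ->]; exists (P ^+ k); rewrite rmorphXn. Qed.

Lemma gen_byZ c J : gen_by J -> gen_by (c *: J).
Proof. by move=> [P ->]; exists (c *: P); rewrite comp_mpolyZ. Qed.

Lemma gen_by_div k J : (0 < k)%N -> gen_by (k%:R * J) -> gen_by J.
Proof.
move=> k0 /(gen_byZ k%:R^-1); rewrite -scaler_nat scaler_nat mulr_natl -scaler_nat.
by rewrite scalerA mulVf ?scale1r // pnatr_eq0 -lt0n.
Qed.

End Subalgebra.

Ltac gen_by_closure := repeat lazymatch goal with
  | |- gen_by _ (_ + _) => apply: gen_byD
  | |- gen_by _ (- _) => apply: gen_byN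
  | |- gen_by _ (_ * _) => apply: gen_byM
  | |- gen_by _ (_ ^+ _) => apply: gen_byX
  | |- gen_by _ 1 => apply: (gen_by_nat _ 1)
  | |- gen_by _ (_%:R) => apply: gen_by_nat
  | |- _ => assumption
  end.

(** Expanding the product of the two shifted elements isolates 49 a b modulo multiples of z. Once
    the multiples of [Z ^+ 2] are generated, all other products of monomials follow. *)
Lemma gen_by_mul_shift (K : numFieldType) (n m : nat) (T : n.-tuple {mpoly K[m]})
    (a b s t z : {mpoly K[m]}) :
  gen_by T (7 * a + s * z) -> gen_by T (7 * b + t * z) -> gen_by T (a * z) ->
  gen_by T (b * z) -> gen_by T s -> gen_by T t -> gen_by T (z * z) ->
  gen_by T (a * b).
Proof.
move=> *; apply: (@gen_by_div _ _ _ _ 49) => //.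
rewrite (_ : _ * _ = (7 * a + s * z) * (7 * b + t * z)
  + - (7 * t * (a * z)) + - (7 * s * (b * z)) + - (s * t * (z * z))); last by ring.
apply: gen_byD; [apply: gen_byD; [apply: gen_byD; first exact: gen_byM|]|].
- by apply/gen_byN/gen_byM => //; apply/gen_byM => //; apply: gen_by_nat.
- by apply/gen_byN/gen_byM => //; apply/gen_byM => //; apply: gen_by_nat.
- by apply/gen_byN/gen_byM => //; apply/gen_byM.
Qed.

Lemma rmorph_wt6_row (A B : comNzRingType) (f : {rmorphism A -> B}) k x y z :
  f (wt6 (calB_row A k) x y z) = wt6 (calB_row B k) (f x) (f y) (f z).
Proof.
case: k => [|[|[|[|[|[|k]]]]]]; rewrite /wt6 /calB_row /= ?nth_nil ?(rmorph0 f); ring.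
Qed.

Section Veronese.
Variables (K : numFieldType) (p q : nat) (T : p.-tuple {mpoly K[q]}).
Variables X Y Z : {mpoly K[q]}.
Let gen := gen_by T.
Hypothesis gen_row : forall k, (k < 6)%N -> gen (wt6 (calB_row _ k) X Y Z).

Definition mon6 (A : comNzRingType) (x y z : A) (i : nat) : A :=
  nth 0 [:: x ^+ 6; x ^+ 4 * y; x ^+ 2 * y ^+ 2; y ^+ 3; x ^+ 3 * z; x * y * z] i.

(* The span of the rows of calB_row consists of the combinations of the
   [7 * mon6 x y z i + mon6_shift i * z ^+ 2]. *)
Definition mon6_shift (A : comNzRingType) (i : nat) : A :=
  nth 0 [:: 18; 268; 518; 768; - 307; - 57] i.

Let w (i : nat) := 7 * mon6 X Y Z i + mon6_shift _ i * Z ^+ 2.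

(** The multipliers invert the matrix of the first six columns of [calB_row], with 10^7 as a common
    denominator; the last column then yields the shift. *)
Lemma gen_w (i : nat) : (i < 6)%N -> gen (w i).
Proof.
have h0 := @gen_row 0 isT; have h1 := @gen_row 1 isT; have h2 := @gen_row 2 isT.
have h3 := @gen_row 3 isT; have h4 := @gen_row 4 isT; have h5 := @gen_row 5 isT.
case: i => [|[|[|[|[|[|i]]]]]]; last (by rewrite !ltnS ltn0); move=> _.
- apply: (@gen_by_div _ _ _ _ (10 ^ 7)); first by rewrite expn_gt0.
  rewrite natrX (_ : _ * _ = (- 2 ^+ 7 * 3 ^+ 2 * 31 * 41 * 43) * wt6 (calB_row _ 0) X Y Z
    + (- 2 ^+ 7 * 3 ^+ 3 * 683) * wt6 (calB_row _ 1) X Y Z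
    + (- 2 ^+ 6 * 3 ^+ 3 * 53) * wt6 (calB_row _ 2) X Y Z
    + (- 2 ^+ 4 * 3 ^+ 2 * 5 ^+ 2) * wt6 (calB_row _ 3) X Y Z
    + (- 144) * wt6 (calB_row _ 4) X Y Z
    + (- 8) * wt6 (calB_row _ 5) X Y Z); last first.
    by rewrite /w /mon6 /mon6_shift /wt6 /calB_row /=; ring.
  move: (wt6 _ _ _ _) (wt6 _ _ _ _) (wt6 _ _ _ _) (wt6 _ _ _ _) (wt6 _ _ _ _)
    (wt6 _ _ _ _) h0 h1 h2 h3 h4 h5 => *.
  by rewrite /gen; gen_by_closure.
- apply: (@gen_by_div _ _ _ _ (10 ^ 7)); first by rewrite expn_gt0.
  rewrite natrX (_ : _ * _ = (- 2 ^+ 12 * 401 * 571) * wt6 (calB_row _ 0) X Y Z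
    + (- ((35 * 1000 + 157) * 1000 + 888)) * wt6 (calB_row _ 1) X Y Z
    + (- 2 ^+ 7 * 3 * 53 * 67) * wt6 (calB_row _ 2) X Y Z
    + (- 2 ^+ 5 * 5 ^+ 2 * 67) * wt6 (calB_row _ 3) X Y Z
    + (- 2 ^+ 5 * 67) * wt6 (calB_row _ 4) X Y Z
    + (- 88) * wt6 (calB_row _ 5) X Y Z); last first.
    by rewrite /w /mon6 /mon6_shift /wt6 /calB_row /=; ring.
  move: (wt6 _ _ _ _) (wt6 _ _ _ _) (wt6 _ _ _ _) (wt6 _ _ _ _) (wt6 _ _ _ _)
    (wt6 _ _ _ _) h0 h1 h2 h3 h4 h5 => *.
  by rewrite /gen; gen_by_closure.
- apply: (@gen_by_div _ _ _ _ (10 ^ 7)); first by rewrite expn_gt0.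
  rewrite natrX (_ : _ * _ = (- (((1 * 1000 + 832) * 1000 + 370) * 1000 + 176)) * wt6
      (calB_row _ 0) X Y Z
    + (- ((68 * 1000 + 515) * 1000 + 328)) * wt6 (calB_row _ 1) X Y Z
    + (- 2 ^+ 6 * 3 * 7 * 37 * 53) * wt6 (calB_row _ 2) X Y Z
    + (- 2 ^+ 4 * 5 ^+ 2 * 7 * 37) * wt6 (calB_row _ 3) X Y Z
    + (- 2 ^+ 4 * 7 * 37) * wt6 (calB_row _ 4) X Y Z
    + (- 168) * wt6 (calB_row _ 5) X Y Z); last first.
    by rewrite /w /mon6 /mon6_shift /wt6 /calB_row /=; ring.
  move: (wt6 _ _ _ _) (wt6 _ _ _ _) (wt6 _ _ _ _) (wt6 _ _ _ _) (wt6 _ _ _ _)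
    (wt6 _ _ _ _) h0 h1 h2 h3 h4 h5 => *.
  by rewrite /gen; gen_by_closure.
- apply: (@gen_by_div _ _ _ _ (10 ^ 7)); first by rewrite expn_gt0.
  rewrite natrX (_ : _ * _ = (- 2 ^+ 21 * 17 * 79) * wt6 (calB_row _ 0) X Y Z
    + (- 2 ^+ 16 * 3 * 521) * wt6 (calB_row _ 1) X Y Z
    + (- 2 ^+ 13 * 3 ^+ 2 * 53) * wt6 (calB_row _ 2) X Y Z
    + (- 2 ^+ 11 * 3 * 5 ^+ 2) * wt6 (calB_row _ 3) X Y Z
    + (- 2 ^+ 11 * 3) * wt6 (calB_row _ 4) X Y Z
    + (- 248) * wt6 (calB_row _ 5) X Y Z); last first.
    by rewrite /w /mon6 /mon6_shift /wt6 /calB_row /=; ring.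
  move: (wt6 _ _ _ _) (wt6 _ _ _ _) (wt6 _ _ _ _) (wt6 _ _ _ _) (wt6 _ _ _ _)
    (wt6 _ _ _ _) h0 h1 h2 h3 h4 h5 => *.
  by rewrite /gen; gen_by_closure.
- apply: (@gen_by_div _ _ _ _ (10 ^ 7)); first by rewrite expn_gt0.
  rewrite natrX (_ : _ * _ = (((1 * 1000 + 75) * 1000 + 843) * 1000 + 72) * wt6
      (calB_row _ 0) X Y Z
    + ((40 * 1000 + 309) * 1000 + 376) * wt6 (calB_row _ 1) X Y Z
    + ((1 * 1000 + 561) * 1000 + 8) * wt6 (calB_row _ 2) X Y Z
    + (2 ^+ 3 * 5 ^+ 2 * 307) * wt6 (calB_row _ 3) X Y Z
    + (2 ^+ 2 * 607) * wt6 (calB_row _ 4) X Y Z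
    + 96 * wt6 (calB_row _ 5) X Y Z); last first.
    by rewrite /w /mon6 /mon6_shift /wt6 /calB_row /=; ring.
  move: (wt6 _ _ _ _) (wt6 _ _ _ _) (wt6 _ _ _ _) (wt6 _ _ _ _) (wt6 _ _ _ _)
    (wt6 _ _ _ _) h0 h1 h2 h3 h4 h5 => *.
  by rewrite /gen; gen_by_closure.
- apply: (@gen_by_div _ _ _ _ (10 ^ 7)); first by rewrite expn_gt0.
  rewrite natrX (_ : _ * _ = ((217 * 1000 + 178) * 1000 + 112) * wt6 (calB_row _ 0) X Y Z
    + ((8 * 1000 + 71) * 1000 + 936) * wt6 (calB_row _ 1) X Y Z
    + (2 ^+ 5 * 17 * 557) * wt6 (calB_row _ 2) X Y Z
    + (2 ^+ 3 * 3 * 5 ^+ 2 * 19) * wt6 (calB_row _ 3) X Y Z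
    + 428 * wt6 (calB_row _ 4) X Y Z
    + 16 * wt6 (calB_row _ 5) X Y Z); last first.
    by rewrite /w /mon6 /mon6_shift /wt6 /calB_row /=; ring.
  move: (wt6 _ _ _ _) (wt6 _ _ _ _) (wt6 _ _ _ _) (wt6 _ _ _ _) (wt6 _ _ _ _)
    (wt6 _ _ _ _) h0 h1 h2 h3 h4 h5 => *.
  by rewrite /gen; gen_by_closure.
Qed.

(* The 21 products w i * w j span the 19-dimensional space of weight 12; the
   combinations below solve for the monomials divisible by Z^2. *)
Lemma gen_mon6_ZZ (i : nat) : (i < 7)%N -> gen (nth (Z ^+ 2) (mkseq (mon6 X Y Z) 6) i *
    Z ^+ 2).
Proof.
have h0 := @gen_w 0 isT; have h1 := @gen_w 1 isT; have h2 := @gen_w 2 isT.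
have h3 := @gen_w 3 isT; have h4 := @gen_w 4 isT; have h5 := @gen_w 5 isT.
(* Five differences, w0 w2 - w1 w1, w0 w3 - w1 w2, w1 w3 - w2 w2, w0 w5 - w1 w4 and w1 w5 - w2 w4,
   cancel their leading monomials; together with w4 w4 and w4 w5 they are seven elements in the span
   of the seven monomials divisible by [Z ^+ 2]. The multipliers invert this 7 x 7 system. Index 6
   falls on the default value of [nth], so the last case is Z^4. *)
case: i => [|[|[|[|[|[|[|i]]]]]]]; last (by rewrite !ltnS ltn0); move=> _.
- apply: (@gen_by_div _ _ _ _ (((47 * 1000 + 851) * 1000 + 562) * 1000 + 500)); first
    by rewrite !(addn_gt0, muln_gt0).
  rewrite (_ : _ * _ = (- 2 * 307 ^+ 2 * 853) * (w 0 * w 2)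
    + (2 * 3 ^+ 2 * 67 * 307 ^+ 2) * (w 0 * w 3)
    + (- 2 ^+ 2 * 5 ^+ 4 * 73 * 307) * (w 0 * w 5)
    + (2 * 307 ^+ 2 * 853) * (w 1 * w 1)
    + (- 2 * 3 ^+ 2 * 67 * 307 ^+ 2) * (w 1 * w 2)
    + (- 3 ^+ 4 * 307 ^+ 2) * (w 1 * w 3)
    + (2 ^+ 2 * 5 ^+ 4 * 73 * 307) * (w 1 * w 4)
    + (2 ^+ 4 * 3 ^+ 3 * 5 ^+ 4 * 307) * (w 1 * w 5)
    + (3 ^+ 4 * 307 ^+ 2) * (w 2 * w 2)
    + (- 2 ^+ 4 * 3 ^+ 3 * 5 ^+ 4 * 307) * (w 2 * w 4)
    + (- 2 ^+ 2 * 5 ^+ 5 * 7 * 593) * (w 4 * w 4)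
    + (2 ^+ 3 * 3 ^+ 2 * 5 ^+ 5 * 307) * (w 4 * w 5)); last first.
    by rewrite /w /mon6 /mon6_shift /=; ring.
  move: (w 0) (w 1) (w 2) (w 3) (w 4) (w 5) h0 h1 h2 h3 h4 h5 => *.
  by rewrite /gen; gen_by_closure.
- apply: (@gen_by_div _ _ _ _ (((47 * 1000 + 851) * 1000 + 562) * 1000 + 500)); first
    by rewrite !(addn_gt0, muln_gt0).
  rewrite (_ : _ * _ = (- (((2 * 1000 + 636) * 1000 + 475) * 1000 + 169)) * (w 0 * w 2)
    + (2 ^+ 2 * 67 ^+ 2 * 307 ^+ 2) * (w 0 * w 3)
    + (- (((1 * 1000 + 232) * 1000 + 433) * 1000 + 750)) * (w 0 * w 5)
    + (((2 * 1000 + 636) * 1000 + 475) * 1000 + 169) * (w 1 * w 1)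
    + (- 2 ^+ 2 * 67 ^+ 2 * 307 ^+ 2) * (w 1 * w 2)
    + (- 2 * 3 ^+ 2 * 67 * 307 ^+ 2) * (w 1 * w 3)
    + (((1 * 1000 + 232) * 1000 + 433) * 1000 + 750) * (w 1 * w 4)
    + (((1 * 1000 + 248) * 1000 + 358) * 1000 + 750) * (w 1 * w 5)
    + (2 * 3 ^+ 2 * 67 * 307 ^+ 2) * (w 2 * w 2)
    + (- (((1 * 1000 + 248) * 1000 + 358) * 1000 + 750)) * (w 2 * w 4)
    + (- 2 ^+ 5 * 5 ^+ 5 * 7 * 13 * 67) * (w 4 * w 4)
    + (((1 * 1000 + 17) * 1000 + 512) * 1000 + 500) * (w 4 * w 5)); last first.
    by rewrite /w /mon6 /mon6_shift /=; ring.
  move: (w 0) (w 1) (w 2) (w 3) (w 4) (w 5) h0 h1 h2 h3 h4 h5 => *.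
  by rewrite /gen; gen_by_closure.
- apply: (@gen_by_div _ _ _ _ (((6 * 1000 + 835) * 1000 + 937) * 1000 + 500)); first by
    rewrite !(addn_gt0, muln_gt0).
  rewrite (_ : _ * _ = (- ((722 * 1000 + 215) * 1000 + 42)) * (w 0 * w 2)
    + ((463 * 1000 + 99) * 1000 + 42) * (w 0 * w 3)
    + (- ((344 * 1000 + 120) * 1000)) * (w 0 * w 5)
    + ((722 * 1000 + 215) * 1000 + 42) * (w 1 * w 1)
    + (- ((463 * 1000 + 99) * 1000 + 42)) * (w 1 * w 2)
    + (- ((31 * 1000 + 103) * 1000 + 667)) * (w 1 * w 3)
    + ((344 * 1000 + 120) * 1000) * (w 1 * w 4)
    + ((344 * 1000 + 832) * 1000 + 500) * (w 1 * w 5)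
    + ((31 * 1000 + 103) * 1000 + 667) * (w 2 * w 2)
    + (- ((344 * 1000 + 832) * 1000 + 500)) * (w 2 * w 4)
    + (- ((166 * 1000 + 787) * 1000 + 500)) * (w 4 * w 4)
    + (2 ^+ 4 * 5 ^+ 5 * 41 * 137) * (w 4 * w 5)); last first.
    by rewrite /w /mon6 /mon6_shift /=; ring.
  move: (w 0) (w 1) (w 2) (w 3) (w 4) (w 5) h0 h1 h2 h3 h4 h5 => *.
  by rewrite /gen; gen_by_closure.
- apply: (@gen_by_div _ _ _ _ (((47 * 1000 + 851) * 1000 + 562) * 1000 + 500)); first
    by rewrite !(addn_gt0, muln_gt0).
  rewrite (_ : _ * _ = (- (((7 * 1000 + 390) * 1000 + 535) * 1000 + 419)) * (w 0 * w 2)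
    + (((4 * 1000 + 734) * 1000 + 395) * 1000 + 294) * (w 0 * w 3)
    + (- (((3 * 1000 + 585) * 1000 + 246) * 1000 + 250)) * (w 0 * w 5)
    + (((7 * 1000 + 390) * 1000 + 535) * 1000 + 419) * (w 1 * w 1)
    + (- (((4 * 1000 + 734) * 1000 + 395) * 1000 + 294)) * (w 1 * w 2)
    + (- ((292 * 1000 + 474) * 1000 + 544)) * (w 1 * w 3)
    + (((3 * 1000 + 585) * 1000 + 246) * 1000 + 250) * (w 1 * w 4)
    + (((3 * 1000 + 579) * 1000 + 296) * 1000 + 250) * (w 1 * w 5)
    + ((292 * 1000 + 474) * 1000 + 544) * (w 2 * w 2)
    + (- (((3 * 1000 + 579) * 1000 + 296) * 1000 + 250)) * (w 2 * w 4)
    + (- (((1 * 1000 + 725) * 1000 + 325) * 1000)) * (w 4 * w 4)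
    + (2 ^+ 2 * 3 * 5 ^+ 5 * 23 * 31 * 109) * (w 4 * w 5)); last first.
    by rewrite /w /mon6 /mon6_shift /=; ring.
  move: (w 0) (w 1) (w 2) (w 3) (w 4) (w 5) h0 h1 h2 h3 h4 h5 => *.
  by rewrite /gen; gen_by_closure.
- apply: (@gen_by_div _ _ _ _ (((95 * 1000 + 703) * 1000 + 125) * 1000)); first by
    rewrite !(addn_gt0, muln_gt0).
  rewrite (_ : _ * _ = (((6 * 1000 + 48) * 1000 + 50) * 1000 + 737) * (w 0 * w 2)
    + (- 2 * 67 * 307 ^+ 3) * (w 0 * w 3)
    + (2 * 3 ^+ 2 * 5 ^+ 4 * 19 * 59 * 229) * (w 0 * w 5)
    + (- (((6 * 1000 + 48) * 1000 + 50) * 1000 + 737)) * (w 1 * w 1)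
    + (2 * 67 * 307 ^+ 3) * (w 1 * w 2)
    + (3 ^+ 2 * 307 ^+ 3) * (w 1 * w 3)
    + (- 2 * 3 ^+ 2 * 5 ^+ 4 * 19 * 59 * 229) * (w 1 * w 4)
    + (- 2 * 5 ^+ 4 * 71 * 167 * 193) * (w 1 * w 5)
    + (- 3 ^+ 2 * 307 ^+ 3) * (w 2 * w 2)
    + (2 * 5 ^+ 4 * 71 * 167 * 193) * (w 2 * w 4)
    + (((1 * 1000 + 346) * 1000 + 537) * 1000 + 500) * (w 4 * w 4)
    + (- (((2 * 1000 + 327) * 1000 + 787) * 1000 + 500)) * (w 4 * w 5)); last first.
    by rewrite /w /mon6 /mon6_shift /=; ring.
  move: (w 0) (w 1) (w 2) (w 3) (w 4) (w 5) h0 h1 h2 h3 h4 h5 => *.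
  by rewrite /gen; gen_by_closure.
- apply: (@gen_by_div _ _ _ _ (((95 * 1000 + 703) * 1000 + 125) * 1000)); first by
    rewrite !(addn_gt0, muln_gt0).
  rewrite (_ : _ * _ = (((1 * 1000 + 4) * 1000 + 59) * 1000 + 237) * (w 0 * w 2)
    + (- ((643 * 1000 + 661) * 1000 + 362)) * (w 0 * w 3)
    + ((480 * 1000 + 476) * 1000 + 250) * (w 0 * w 5)
    + (- (((1 * 1000 + 4) * 1000 + 59) * 1000 + 237)) * (w 1 * w 1)
    + ((643 * 1000 + 661) * 1000 + 362) * (w 1 * w 2)
    + ((43 * 1000 + 230) * 1000 + 987) * (w 1 * w 3)
    + (- ((480 * 1000 + 476) * 1000 + 250)) * (w 1 * w 4)
    + (- 2 * 5 ^+ 4 * 47 * 59 * 137) * (w 1 * w 5)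
    + (- ((43 * 1000 + 230) * 1000 + 987)) * (w 2 * w 2)
    + (2 * 5 ^+ 4 * 47 * 59 * 137) * (w 2 * w 4)
    + (2 ^+ 2 * 5 ^+ 5 * 7 ^+ 2 * 13 * 29) * (w 4 * w 4)
    + (- ((430 * 1000 + 912) * 1000 + 500)) * (w 4 * w 5)); last first.
    by rewrite /w /mon6 /mon6_shift /=; ring.
  move: (w 0) (w 1) (w 2) (w 3) (w 4) (w 5) h0 h1 h2 h3 h4 h5 => *.
  by rewrite /gen; gen_by_closure.
- apply: (@gen_by_div _ _ _ _ (((6 * 1000 + 835) * 1000 + 937) * 1000 + 500)); first by
    rewrite !(addn_gt0, muln_gt0).
  rewrite (_ : _ * _ = ((19 * 1000 + 712) * 1000 + 433) * (w 0 * w 2)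
    + (- ((12 * 1000 + 637) * 1000 + 808)) * (w 0 * w 3)
    + ((9 * 1000 + 411) * 1000 + 250) * (w 0 * w 5)
    + (- ((19 * 1000 + 712) * 1000 + 433)) * (w 1 * w 1)
    + ((12 * 1000 + 637) * 1000 + 808) * (w 1 * w 2)
    + (848 * 1000 + 808) * (w 1 * w 3)
    + (- ((9 * 1000 + 411) * 1000 + 250)) * (w 1 * w 4)
    + (- ((9 * 1000 + 323) * 1000 + 750)) * (w 1 * w 5)
    + (- (848 * 1000 + 808)) * (w 2 * w 2)
    + ((9 * 1000 + 323) * 1000 + 750) * (w 2 * w 4)
    + (2 ^+ 2 * 3 * 5 ^+ 5 * 7 * 17) * (w 4 * w 4)
    + (- 2 ^+ 2 * 5 ^+ 5 * 607) * (w 4 * w 5)); last first.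
    by rewrite /w /mon6 /mon6_shift /=; ring.
  move: (w 0) (w 1) (w 2) (w 3) (w 4) (w 5) h0 h1 h2 h3 h4 h5 => *.
  by rewrite /gen; gen_by_closure.
Qed.

Lemma gen_mon6_mul (i j : nat) : (i < 6)%N -> (j < 6)%N ->
  gen (mon6 X Y Z i * mon6 X Y Z j).
Proof.
move=> i6 j6; have gZ k : (k < 6)%N -> gen (mon6 X Y Z k * Z ^+ 2).
  by move=> k6; have := gen_mon6_ZZ (ltnW k6 : k < 7)%N; rewrite nth_mkseq.
have gZZ : gen (Z ^+ 2 * Z ^+ 2) by apply: (gen_mon6_ZZ (isT : 6 < 7)%N).
have gq k : gen (mon6_shift _ k).
  rewrite /gen; move: k => [|[|[|[|[|[|k]]]]]]; rewrite /mon6_shift /= ?nth_nil;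
  by [gen_by_closure | apply: (gen_by_nat _ 0)].
exact: gen_by_mul_shift (gen_w i6) (gen_w j6) (gZ i i6) (gZ j j6) (gq i) (gq j) gZZ.
Qed.

Definition mono (t : nat * nat * nat) := X ^+ t.1.1 * Y ^+ t.1.2 * Z ^+ t.2.

Let T6 := [:: (6, 0, 0); (4, 1, 0); (2, 2, 0); (0, 3, 0); (3, 0, 1); (1, 1, 1); (0, 0,
    2)]%N.

Lemma gen_mono_mul t u : t \in T6 -> u \in T6 -> gen (mono t * mono u).
Proof.
have TE v : v \in T6 -> mono v = Z ^+ 2 \/ exists2 i, (i < 6)%N & mono v = mon6 X Y Z i.
  rewrite !inE => /or4P [|||/or4P[]] /eqP ->; rewrite /mono /=;
    [right; exists 0%N|right; exists 1%N|right; exists 2|right; exists 3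
    |right; exists 4|right; exists 5|left]; rewrite ?expr0 ?expr1 ?mulr1 ?mul1r //.
move=> /TE [->|[i i6 ->]] /TE [->|[j j6 ->]].
- exact: (gen_mon6_ZZ (isT : 6 < 7)%N).
- by rewrite mulrC; have := gen_mon6_ZZ (ltnW j6 : j < 7)%N; rewrite nth_mkseq.
- by have := gen_mon6_ZZ (ltnW i6 : i < 7)%N; rewrite nth_mkseq.
- exact: gen_mon6_mul.
Qed.

(** A monomial with i >= 6, j >= 3 or k >= 2 contains x^6, y^3 or z^2. Otherwise finitely many
    exponents remain, and each of positive weight divisible by 6 is checked directly. *)
Lemma weight6_factor (i j k n : nat) : (i + 2 * j + 3 * k = 6 * n.+1)%N ->
  exists2 t, t \in T6 & exists i' j' k',
    [/\ i = t.1.1 + i', j = t.1.2 + j', k = t.2 + k' & i' + 2 * j' + 3 * k' = 6 * n]%N.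
Proof.
move=> E; suff [t tT /and3P[ti tj tk]] : exists2 t, t \in T6 &
    [&& t.1.1 <= i, t.1.2 <= j & t.2 <= k]%N.
  exists t => //; exists (i - t.1.1)%N, (j - t.1.2)%N, (k - t.2)%N.
  have tw : (t.1.1 + 2 * t.1.2 + 3 * t.2 = 6)%N.
    by move: tT; rewrite !inE => /or4P [|||/or4P[]] /eqP ->.
  by split; lia.
have [i6|i6] := leqP 6 i; first by exists (6, 0, 0)%N; rewrite ?inE //= i6.
have [j3|j3] := leqP 3 j; first by exists (0, 3, 0)%N; rewrite ?inE //= j3.
have [k2|k2] := leqP 2 k; first by exists (0, 0, 2)%N; rewrite ?inE //= k2.
suff /hasP : has (fun t : nat * nat * nat => [&& t.1.1 <= i, t.1.2 <= j & t.2 <= k]%N)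
    T6 by [].
have : (6 %| i + 2 * j + 3 * k)%N && (0 < i + 2 * j + 3 * k)%N by rewrite E dvdn_mulr.
by move: i j k i6 j3 k2 {E} => [|[|[|[|[|[|//]]]]]] [|[|[|//]]] [|[|//]].
Qed.

Lemma monoD t i j k :
  mono (t.1.1 + i, t.1.2 + j, t.2 + k)%N = mono t * mono (i, j, k).
Proof.
rewrite /mono /= (exprD X) (exprD Y) (exprD Z).
by rewrite [RHS]mulrACA [X ^+ _ * _ * (_ * _)]mulrACA.
Qed.

Lemma gen_mono12 (n i j k : nat) : (i + 2 * j + 3 * k = 12 * n)%N -> gen (mono (i, j, k)).
Proof.
elim: n i j k => [|n IHn] i j k.
  rewrite muln0 => E; have [-> -> ->] : [/\ i = 0, j = 0 & k = 0]%N by split; lia.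
  by rewrite /mono /= !expr0 !mulr1; apply: (gen_by_nat _ 1).
rewrite (_ : (12 * n.+1 = 6 * (2 * n).+2)%N); last by lia.
move=> /weight6_factor [t tT [i1 [j1 [k1 [-> -> ->]]]]].
move=> /weight6_factor [u uT [i2 [j2 [k2 [-> -> ->]]]]] E.
have -> : mono (t.1.1 + (u.1.1 + i2), t.1.2 + (u.1.2 + j2), t.2 + (u.2 + k2))%N
    = mono t * mono u * mono (i2, j2, k2) by rewrite (monoD t) (monoD u) mulrA.
by apply: gen_byM; [apply: gen_mono_mul | apply: IHn; rewrite E; lia].
Qed.

End Veronese.

(** * Invariants of degree divisible by 48 as polynomials in the B_k *)

Section Main.
Variables (K : numClosedFieldType) (B : 'I_6 -> {mpoly K[6]}).
Hypothesis hB : forall (k : 'I_6) (l : 'I_5 -> K * K),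
  (B k).@[bcoef (quintic l)] = (calB_poly l)`_(5 - k).

Let X := I4P K.
Let Y := 2 ^+ 7 * I8P K.
Let Z := 2 ^+ 11 * I12P K.
Let gen := gen_by [tuple B k | k < 6].

Lemma gen_row (k : nat) : (k < 6)%N -> gen (wt6 (calB_row _ k) X Y Z).
Proof.
move=> k6; apply: (@gen_by_div _ _ _ _ (5 ^ 15)); first by rewrite expn_gt0.
have -> : (5 ^ 15)%N%:R * wt6 (calB_row _ k) X Y Z
    = (3 ^+ (3 * k) * 2 ^+ 40) *: B (Ordinal k6).
  apply: mpoly_eq_meval => a; rewrite mevalZ (calB_formula (hB (Ordinal k6))) /=.
  rewrite -I4P_meval -I8P_meval -I12P_meval mevalM natrX rmorphXn rmorph_nat.
  have YE : Y.@[a] = 2 ^+ 7 * (I8P K).@[a] by rewrite mevalM rmorphXn rmorph_nat.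
  have ZE : Z.@[a] = 2 ^+ 11 * (I12P K).@[a].
    by rewrite mevalM rmorphXn rmorph_nat.
  by rewrite rmorph_wt6_row /= YE ZE.
by apply: gen_byZ; have := gen_by_tnth [tuple B k | k < 6] (Ordinal k6); rewrite
    tnth_mktuple.
Qed.

Theorem sl2_invariant_calB d (J : {mpoly K[6]}) :
  sl2_invariant J -> J \is d.-homog -> (48 %| d)%N -> gen J.
Proof.
move=> invJ hJ /dvdnP[n dE].
have d4 : (4 %| d)%N by rewrite dE (dvdn_mull n (isT : 4 %| 48)%N).
have [P -> wP] := sl2_invariant_generators invJ hJ d4.
rewrite comp_mpolyEX big_seq; apply: (big_ind gen) => [||m mP].
- exact: (gen_by_nat _ 0).
- exact: gen_byD.
apply: gen_byZ; rewrite comp_mpolyX !big_ord_recl big_ord0 mulr1 !(tnth_nth 0) /=.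
rewrite (_ : lift ord0 (lift ord0 ord0) = 2%R); last exact: val_inj.
rewrite (_ : lift ord0 ord0 = 1); last exact: val_inj.
rewrite (_ : ord0 = 0); last exact: val_inj.
have E : (m 0%R + 2 * m 1%R + 3 * m 2%R = 12 * n)%N.
  by have := wP m mP; rewrite dE; move: (m 0) (m 1) (m 2%R) => *; lia.
(* This power of two turns the monomial in [I4P], [I8P], [I12P] into the one in the scaled
   generators [X], [Y], [Z]. *)
apply: (@gen_by_div _ _ _ _ ((2 ^ 7) ^ m 1%R * (2 ^ 11) ^ m 2%R)).
  by rewrite muln_gt0 !expn_gt0.
have := gen_mono12 gen_row E; rewrite /mono /= /Y /Z (exprMn _ (2 ^+ 7)) (exprMn _ (2
    ^+ 11)); congr gen.
rewrite natrM !natrX; move: (_ ^+ m 0) (_ ^+ m 1) (_ ^+ m 1) (_ ^+ m 2%R) (_ ^+ m 2%R)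
    => *; ring.
Qed.

End Main.

Lemma is_invariant_sl2 (K : fieldType) p d (J : {mpoly K[p.+1]}) :
  is_invariant d J -> sl2_invariant J.
Proof.
case=> _ [w inv] g dg a; rewrite inv ?unitmxE ?dg ?unitr1 //.
by rewrite exp1rz mul1r.
Qed.

Theorem theorem3p6 (R : realType) (d : nat) (hd : (0 < d)%N)
    (h48 : (48 %| d)%N) (I : {mpoly R[i][6]}) (hI : is_invariant d I) :
  exists P : {mpoly R[i][6]}, I = P \mPo [tuple calB R k | k < 6].
Proof.
exact: (sl2_invariant_calB (@calBP R) (is_invariant_sl2 hI) (proj1 hI) h48).
Qed.
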